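(* Let $A:\mathbb{R}^n\to\mathbb{R}^{n\times n}$ be symmetric-matrix valued, three times continuously differentiable at every $v\neq 0$, with $A(\alpha v)=A(v)$ for all $\alpha\in\mathbb{R}\setminus\{0\}$; let $J(v):=\frac{\partial}{\partial v}(A(v)v)$ and $p(y):=\frac{y^TA(y)y}{y^Ty}$. Consider the ODE $$y'(t)=p(y(t))y(t)-A(y(t))y(t),\qquad y(0)=y_0,\ \|y_0\|_2=1.$$ Then: (a) $\|y(t)\|_2=1$ for all $t$. (b) Any stationary point of the ODE is a normalized eigenvector of the problem $A(v)v=\lambda v$. (c) Any normalized eigenvector $v$ (i.e., $\|v\|_2=1$ and $A(v)v=\lambda v$ for some $\lambda\in\mathbb{R}$) is a stationary point of the ODE. (d) If $y_*$ is a stationary point and $\lambda_*=p(y_* )$ is a simple eigenvalue of $J(y_* )$ with $\lambda_*<\operatorname{Re}(\mu)$ for all $\mu\in\lambda(J(y_* ))\setminus\{\lambda_*\}$, then $y_*$ is stable. (e) If $y_*$ is a stationary point and there is an eigenvalue $\mu$ of $J(y_* )$ with $\operatorname{Re}(\mu)<\lambda_*=p(y_* )$, then $y_*$ is unstable.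
   Context: $\lambda(M)$ denotes the set of eigenvalues of a matrix $M$; stability refers to stability of the stationary point of the ODE. *)

(* Defs.v *)
From HB Require Import structures.
From mathcomp Require Import all_boot all_order all_algebra.
From mathcomp Require Import all_classical all_reals all_analysis.
From mathcomp Require Import complex.
Set Implicit Arguments. Unset Strict Implicit. Unset Printing Implicit Defensive.
Import Order.TTheory GRing.Theory Num.Theory.
Import numFieldNormedType.Exports.
Local Open Scope ring_scope.

Section Defs.
Variables (R : realType) (n : nat).
Notation vec := 'cV[R]_n.

Definition ei (i : 'I_n) : vec := delta_mx i 0.

Definition norm2 (v : vec) : R := Num.sqrt ((v^T *m v) 0 0).

Fixpoint Ck_nz {W : normedModType R} (k : nat) (f : vec -> W) : Prop :=
  match k with
  | 0 => forall v : vec, v != 0 -> {for v, continuous f}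
  | k'.+1 => (forall v : vec, v != 0 -> {for v, continuous f}) /\
             (forall (v : vec) (i : 'I_n), v != 0 -> derivable f v (ei i)) /\
             (forall i : 'I_n, Ck_nz k' (fun v => 'D_(ei i) f v))
  end.

Definition rayleigh (A : vec -> 'M[R]_n) (y : vec) : R :=
  (y^T *m A y *m y) 0 0 / (y^T *m y) 0 0.

Definition rhs (A : vec -> 'M[R]_n) (y : vec) : vec :=
  rayleigh A y *: y - A y *m y.

Definition jac (A : vec -> 'M[R]_n) (v : vec) : 'M[R]_n :=
  \matrix_(i, j) ('D_(ei j) (fun w : vec => A w *m w) v) i 0.

Definition is_solution (A : vec -> 'M[R]_n) (y : R -> vec) : Prop :=
  forall t : R, is_derive t 1 y (rhs A (y t)).

(* stationary point of the ODE (posed on the unit sphere, ||y0|| = 1) *)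
Definition stationary (A : vec -> 'M[R]_n) (y : vec) : Prop :=
  norm2 y = 1 /\ rhs A y = 0.

Definition normalized_eigvec (A : vec -> 'M[R]_n) (v : vec) : Prop :=
  norm2 v = 1 /\ exists lambda : R, A v *m v = lambda *: v.

Definition lyap_stable (A : vec -> 'M[R]_n) (ys : vec) : Prop :=
  forall eps : R, 0 < eps -> exists2 delta : R, 0 < delta &
    forall y : R -> vec, is_solution A y -> norm2 (y 0) = 1 ->
      norm2 (y 0 - ys) < delta -> forall t : R, 0 <= t -> norm2 (y t - ys) < eps.

Definition lyap_unstable (A : vec -> 'M[R]_n) (ys : vec) : Prop :=
  ~ lyap_stable A ys.

Definition cmx (M : 'M[R]_n) : 'M[R[i]]_n := map_mx (fun x : R => (x%:C)%C) M.

Definition spectrum (M : 'M[R]_n) (mu : R[i]) : bool := eigenvalue (cmx M) mu.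

Definition alg_mult (M : 'M[R]_n) (mu : R[i]) : nat := mup mu (char_poly (cmx M)).

End Defs.

(* Main.v *)
Require Import Defs.
From HB Require Import structures.
From mathcomp Require Import all_boot all_order all_algebra.
From mathcomp Require Import all_classical all_reals all_analysis.
From mathcomp Require Import complex ring lra.
Import Order.TTheory GRing.Theory Num.Theory.
Import numFieldNormedType.Exports.
Local Open Scope ring_scope.
Local Open Scope classical_set_scope.

(** Write [F v = A v *m v], [J] for its Jacobian at a stationary point [ys] and [lam] for the
    eigenvalue.  Since [y^T rhs(y) = 0], the flow preserves the sphere.  For [y] on the sphere,
    [rhs y = M (y - ys) + o(y - ys)] with [M = - (1 - ys ys^T) (J - lam) - ys ys^T]; the last term
    is harmless because [ys^T (y - ys) = - |y - ys|^2 / 2] there.  Besides [-1],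
      the eigenvalues of
    [M] are the numbers [lam - mu], [mu] an eigenvalue of [J], and [0] drops out when [lam] is
    simple.  When no eigenvalue of [M] has real part [beta], a Schur basis of [M] yields a
    symmetric [S] such that the derivative of [V = x^T S x] along [x' = M x] exceeds [2 beta V] by
    a positive definite form.  In the stable case [beta = 0] and [- V] is a Lyapunov function; in
    the unstable case [0 < beta] and [V] takes positive values, hence grows exponentially along
    some solution starting near [ys].  Such a solution exists globally because [F], hence
    [rhs], is homogeneous of degree 1 and therefore globally Lipschitz. *)

(** * Calculus of one real variable *)

(** The summand [- ys ys^T] of [M] is there because [(J - lam) ys = 0]: without it [0] would always
    be an eigenvalue of [M]. It turns the normal direction into one of decay, so that a matrix on
    the whole space replaces the restriction to the tangent space. [J] may have non-real eigenvalues
    and no eigenbasis, hence the Schur form. In the unstable case [beta = 0] would not do, since [M]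
    may also have eigenvalues on the imaginary axis; only finitely many real parts have to be
    avoided. Instability denies a statement about solutions on all of [R], so it takes an actual
    one, whereas stability only concerns given ones. [A] is not assumed continuous at the origin,
    which the Lipschitz bounds must circumvent. The norm [|.|] is the maximum norm, whence the
    factors [n%:R] in bounds for products. *)

Lemma is_derive1_continuous {R : realType} {V : normedModType R} (f : R -> V) (df : V) (t : R) :
  is_derive t 1 f df -> {for t, continuous f}.
Proof. by move=> [dfl _]; exact/differentiable_continuous/derivable1_diffP. Qed.

(** An integral with a fixed lower end is a primitive only to the right of that end. The end is
    therefore [- (|t| + 1)], which moves with [t]; subtracting the value at [0] makes the result
    independent of it. *)
Lemma ex_antiderivative {R : realType} (f : R -> R) : continuous f ->
  exists2 F : R -> R, F 0 = 0 & forall t : R, is_derive t 1 F (f t).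
Proof.
move=> cf.
pose G (N t : R) : R := (\int[lebesgue_measure]_(x in `[- N, t]) f x)%R.
have dG (N t : R) : - N < t -> is_derive t 1 (G N) (f t).
  move=> Nt.
  have intf : lebesgue_measure.-integrable `[- N, t + 1] (EFin \o f).
    apply: continuous_compact_integrable; first exact: segment_compact.
    exact: continuous_subspaceT.
  have tt1 : t < t + 1 by rewrite ltrDl.
  have [dF FE] := continuous_FTC1_closed tt1 intf Nt (cf t).
  apply: DeriveDef; [exact: dF|rewrite -derive1E; exact: FE].
have GE (N M t : R) : - N < t -> - M < t -> - N < 0 -> - M < 0 ->
    G N t - G N 0 = G M t - G M 0.
  move=> Nt Mt N0 M0.
  pose h := G N - G M.
  have dh (x : R) : - N < x -> - M < x -> is_derive x 1 h 0.
    move=> Nx Mx; rewrite -(subrr (f x)); apply: is_deriveB; exact: dG.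
  have hE (a b : R) : a < b -> - N < a -> - M < a -> h a = h b.
    move=> ab Na Ma.
    have [||c _] := @MVT_segment R h (fun=> 0) _ _ (ltW ab).
    + move=> x; rewrite in_itv/= => /andP[ax _].
      by apply: dh; exact: lt_trans ax.
    + apply: continuous_in_subspaceT => y; rewrite inE /= in_itv/= => /andP[ay _].
      by apply: is_derive1_continuous; apply: dh; exact: lt_le_trans ay.
    + by rewrite mul0r => /eqP; rewrite subr_eq0 => /eqP ->.
  have {hE}: h t = h 0 by have [t0|t0|->//] := ltgtP t 0; [exact: hE|rewrite -(hE 0 t)].
  rewrite /h !fctE => e; apply/eqP; rewrite subr_eq addrAC -addrA addrC -subr_eq.
  exact/eqP.
exists (fun t => G (`|t| + 1) t - G (`|t| + 1) 0); first by rewrite subrr.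
have absN (t : R) : - (`|t| + 1) < t /\ - (`|t| + 1) < 0.
  split; last by rewrite oppr_lt0 ltr_wpDl.
  by rewrite ltrNl (@le_lt_trans _ _ `|t|) ?ltrDl// ler_normr lexx orbT.
move=> t.
(* Near [t] the moving lower end may be frozen at its value for [t]. *)
apply: (@near_eq_is_derive _ _ _ (fun x => G (`|t| + 1) x - G (`|t| + 1) 0)).
  have : \forall x \near t, - (`|t| + 1) < x.
    by apply: lt_nbhsr; case: (absN t).
  apply: filterS => x tx; apply: GE => //; by [case: (absN t)|case: (absN x)].
rewrite -[f t]subr0; apply: is_deriveB; apply: dG; by case: (absN t).
Qed.

Lemma le_mx_entry {R : realType} {m n : nat} (M : 'M[R]_(m, n)) i j : `|M i j| <= `|M|.
Proof.
rewrite [leRHS]/Num.Def.normr/= mx_normrE.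
exact: (le_bigmax _ (fun ij => `|M ij.1 ij.2|) (i, j)).
Qed.

Lemma mx_norm_le {R : realType} {m n : nat} (M : 'M[R]_(m, n)) (c : R) :
  0 <= c -> (forall i j, `|M i j| <= c) -> `|M| <= c.
Proof.
move=> c0 Mc; rewrite [leLHS]/Num.Def.normr/= mx_normrE (bigmax_le _ c0)//= => -[i j] _.
Qed.

Lemma is_derive_mx {R : realType} {V : normedModType R} {m n : nat} (M : V -> 'M[R]_(m, n))
    (dM : 'M[R]_(m, n)) (t v : V) :
  is_derive t v M dM <-> forall i j, is_derive t v (fun x => M x i j) (dM i j).
Proof.
split=> [[Md <-] i j|dMij].
- apply: DeriveDef; first exact: (derivable_mxP _ _ _).1.
  by rewrite derive_mx// mxE.
- have dM' : derivable M t v by apply/derivable_mxP => i j; case: (dMij i j).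
  apply: DeriveDef => //; rewrite derive_mx//; apply/matrixP => i j; rewrite mxE.
  by case: (dMij i j).
Qed.

Lemma continuous_mx {R : realType} {T : topologicalType} {m n : nat} (M : T ->
    'M[R]_(m, n)) (t : T) :
  (forall i j, {for t, continuous (fun x => M x i j)}) -> {for t, continuous M}.
Proof.
move=> cM; apply/cvgrPdist_le => e e0; near=> x.
apply: mx_norm_le; first exact: ltW.
move=> i j; rewrite !mxE; move: i j; near: x.
apply: filter_forall => i; apply: filter_forall => j.
exact: ((cvgrPdist_le _ _).1 (cM i j)).
Unshelve. all: by end_near. Qed.

Lemma derive1_ge0_le {R : realType} (f df : R -> R) (a b : R) :
  (forall t : R, is_derive t 1 f (df t)) -> a <= b ->
  (forall t, a < t < b -> 0 <= df t) -> f a <= f b.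
Proof.
move=> fdf; rewrite le_eqVlt => /predU1P[->//|ab] df0.
have [|c cab E] := @MVT R f df _ _ ab.
- by apply: continuous_subspaceT => x; exact: is_derive1_continuous (fdf x).
- by rewrite -subr_ge0 E mulr_ge0 ?subr_ge0 ?(ltW ab)// df0//; move: cab; rewrite in_itv.
Qed.

(** Both [g - h] and [g + h] are nondecreasing and vanish at [0]. For negative [t] this gives
    [g t <= 0], hence the absolute value on the right. *)
Lemma norm_derive1_le {R : realType} (h dh g dg : R -> R) :
  (forall t : R, is_derive t 1 h (dh t)) -> (forall t : R, is_derive t 1 g (dg t)) ->
  h 0 = 0 -> g 0 = 0 -> (forall t, `|dh t| <= dg t) -> forall t, `|h t| <= `|g t|.
Proof.
move=> hd gd h0 g0 dhg.
have mono (s t : R) : s <= t -> g s - h s <= g t - h t /\ g s + h s <= g t + h t.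
  move=> st; split.
  - apply: (@derive1_ge0_le _ (g - h) (fun t => dg t - dh t)) => // x _.
    by rewrite subr_ge0 (le_trans (ler_norm _)).
  - apply: (@derive1_ge0_le _ (g + h) (fun t => dg t + dh t)) => // x _.
    by rewrite -[X in _ <= X]opprK oppr_ge0 opprD addrC subr_le0 (le_trans _ (dhg x))// ler_normr
      lexx orbT.
move=> t; rewrite ler_norml.
have [t0|t0] := leP 0 t.
- have [] := mono _ _ t0; rewrite g0 h0 subrr addr0 => A B.
  have := ler_norm (g t); lra.
- have [] := mono _ _ (ltW t0); rewrite g0 h0 subrr addr0 => A B.
  have := ler_norm (- g t); rewrite normrN; lra.
Qed.

(** * Global solutions of Lipschitz differential equations *)

Lemma ex_geometric_lt {R : realType} (C e : R) : 0 < e -> exists k, C * 2^-1 ^+ k < e.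
Proof.
move=> e0.
have /cvgr_lt/(_ _ e0)[k _ kP] : (fun k => C * 2^-1 ^+ k : R) @ \oo --> (0 : R).
  rewrite -(mulr0 C); apply: cvgMr.
  by apply: cvg_expr; rewrite ger0_norm ?invr_ge0// invf_lt1// ltr1n.
by exists k; apply: kP => /=.
Qed.

Lemma ex_geometric_limit {R : realType} {n : nat} (u : nat -> 'cV[R]_n) (C : R) :
  (forall k, `|u k.+1 - u k| <= C * 2^-1 ^+ k) ->
  exists l, forall k, `|l - u k| <= 2 * C * 2^-1 ^+ k.
Proof.
move=> uC.
have h0 k : 0 <= 2^-1 ^+ k :> R by rewrite exprn_ge0.
have C0 : 0 <= C by have := le_trans (normr_ge0 _) (uC 0); rewrite expr0 mulr1.
(* The right-hand side is the geometric sum of [C * 2^-1 ^+ i] for [k <= i < k + m] in closed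
   form. *)
have tele k m : `|u (k + m)%N - u k| <= 2 * C * 2^-1 ^+ k - 2 * C * 2^-1 ^+ (k + m).
  elim: m => [|m IH]; first by rewrite addn0 !subrr normr0.
  rewrite addnS -(subrKA (u (k + m)%N)) (le_trans (ler_normD _ _))//.
  have := uC (k + m)%N; rewrite exprS; lra.
have tail k m : (k <= m)%N -> `|u m - u k| <= 2 * C * 2^-1 ^+ k.
  move=> km; rewrite -(subnKC km) (le_trans (tele _ _))// lerBlDr lerDl.
  by rewrite mulr_ge0// mulr_ge0.
have /cauchy_cvgP/cvg_ex[l ul] : cauchy (u @ \oo).
  apply: cauchy_exP => e e0.
  have [k kP] := ex_geometric_lt (2 * C) e e0.
  exists (u k); exists k => // m km /=.
  by rewrite -ball_normE /= distrC (le_lt_trans (tail _ _ km)).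
exists l => k.
have : `|u m - u k| @[m --> \oo] --> `|l - u k|.
  by apply: cvg_norm; apply: cvgB => //; exact: cvg_cst.
move=> /cvgr_to_le; apply; exists k => // m; exact: tail.
Qed.

Lemma ex_antiderivative_cV {R : realType} {n : nat} (f : R -> 'cV[R]_n) (y0 : 'cV[R]_n) :
  continuous f -> exists2 F : R -> 'cV[R]_n, F 0 = y0 & forall t : R, is_derive t 1 F (f t).
Proof.
move=> cf.
have cfi i : continuous (fun t => f t i 0).
  move=> t; apply: (@continuous_comp _ _ _ f (fun M : 'cV[R]_n => M i 0)); first exact: cf.
  exact: coord_continuous.
have FP i := cid2 (ex_antiderivative (fun t => f t i 0) (cfi i)).
exists (fun t => y0 + \col_i sval (FP i) t).
  by apply/colP => i; rewrite !mxE; case: (FP i) => /= G -> _; rewrite addr0.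
move=> t; apply/is_derive_mx => i j; rewrite (ord1 j).
rewrite (_ : (fun x => _) = cst (y0 i 0) + sval (FP i)); last first.
  by apply/funext => x; rewrite !mxE.
by rewrite -[f t i 0]add0r; apply: is_deriveD; case: (FP i).
Qed.

Lemma norm_derive1_le_cV {R : realType} {n : nat} (h dh : R -> 'cV[R]_n) (g dg : R -> R) :
  (forall t : R, is_derive t 1 h (dh t)) -> (forall t : R, is_derive t 1 g (dg t)) ->
  h 0 = 0 -> g 0 = 0 -> (forall t, `|dh t| <= dg t) -> forall t, `|h t| <= `|g t|.
Proof.
move=> hd gd h0 g0 dhg t; apply: mx_norm_le => // i j.
apply: (@norm_derive1_le _ (fun t => h t i j) (fun t => dh t i j) g dg) => //.
- by move=> s; exact: (is_derive_mx _ _ _ _).1.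
- by rewrite h0 mxE.
- by move=> s; rewrite (le_trans (le_mx_entry _ _ _)).
Qed.

Lemma continuous_lipschitz {R : realType} {V W : normedModType R} (f : V -> W) (L : R) :
  (forall x y, `|f x - f y| <= L * `|x - y|) -> continuous f.
Proof.
move=> fL x; apply/cvgrPdist_le => e e0.
near=> y; rewrite (le_trans (fL _ _))//.
have : `|x - y| <= e / (`|L| + 1).
  near: y; apply: (@cvgr_dist_le _ _ _ _ _ id x); first exact: cvg_id.
  by rewrite divr_gt0// ltr_wpDl.
rewrite ler_pdivlMr ?ltr_wpDl// => /(le_trans _); apply.
by rewrite mulrC ler_wpM2l// (le_trans (ler_norm L))// lerDl.
Unshelve. all: by end_near. Qed.

(* The Picard iterates converge geometrically in the norm weighted by [cosh (2 L t)]. *)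
Lemma ex_global_solution {R : realType} {n : nat} (f : 'cV[R]_n -> 'cV[R]_n) (L : R) :
  0 < L -> (forall x y, `|f x - f y| <= L * `|x - y|) -> forall y0,
  exists2 y : R -> 'cV[R]_n, y 0 = y0 & forall t : R, is_derive t 1 y (f (y t)).
Proof.
move=> L0 fL y0.
have cf : continuous f by exact: continuous_lipschitz fL.
(* The primitive [W] of the weight is at most [w / K], so one Picard step multiplies a weighted
   bound by [L / K = 1 / 2]. The weight has both exponentials in order to serve negative times
   too. *)
pose K := 2 * L.
have K0 : 0 < K by rewrite mulr_gt0.
pose w (t : R) := expR (K * t) + expR (- K * t).
pose W (t : R) := (expR (K * t) - expR (- K * t)) / K.
have dexp (a t : R) : is_derive t 1 (fun t => expR (a * t)) (a * expR (a * t)).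
  rewrite mulrC; apply: (@is_derive1_comp _ expR (fun t => a * t)).
  rewrite (_ : (fun t => _) = a *: id) //; rewrite -[X in is_derive _ _ _ X]mulr1.
  exact: is_deriveZ.
have dW (t : R) : is_derive t 1 W (w t).
  rewrite (_ : W = K^-1 *: ((fun t => expR (K * t)) - (fun t => expR (- K * t)))); last first.
    by apply/funext => x; rewrite /W mulrC.
  apply: is_derive_eq; rewrite /w /GRing.scale/=; field.
  by rewrite gt_eqF.
have W0 : W 0 = 0 by rewrite /W !mulr0 subrr mul0r.
have w1 t : 1 <= w t.
  have [t0|t0] := leP 0 t.
    by rewrite ler_wpDr ?expR_ge0// -expR0 ler_expR mulr_ge0// ltW.
  by rewrite ler_wpDl ?expR_ge0// -expR0 ler_expR mulNr oppr_ge0 nmulr_lle0// ltW.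
have w0 t : 0 <= w t by rewrite (le_trans _ (w1 t)).
have Ww t : `|W t| <= w t / K.
  have Ki0 : 0 <= K^-1 by rewrite invr_ge0 ltW.
  rewrite normrM (ger0_norm Ki0); apply: ler_wpM2r => //.
  rewrite (le_trans (ler_normB _ _))// /w.
  by rewrite !ger0_norm ?expR_ge0.
have cmp (h dh : R -> 'cV[R]_n) (c : R) : (forall t : R, is_derive t 1 h (dh t)) -> h 0 = 0 ->
    0 <= c -> (forall t, `|dh t| <= c * w t) -> forall t, `|h t| <= c * (w t / K).
  move=> hd h0 c0 dhc t.
  have := @norm_derive1_le_cV _ _ h dh (c *: W) (fun t => c * w t) hd.
  move=> /(_ (fun t => is_deriveZ _ _) h0).
  rewrite fctE W0 scaler0 => /(_ erefl dhc t) /le_trans; apply.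
  by rewrite normrZ ger0_norm// ler_wpM2l.
(* Continuity is a premise inside the existential so that [choice] yields a total operator to
   iterate. *)
have step (y : R -> 'cV[R]_n) : exists z : R -> 'cV[R]_n, continuous y ->
    z 0 = y0 /\ forall t : R, is_derive t 1 z (f (y t)).
  have [cy|] := pselect (continuous y); last by exists (fun=> 0).
  have [z ? ?] := ex_antiderivative_cV (f \o y) y0
    (fun t => continuous_comp (cy t) (cf (y t))).
  by exists z.
have [P PP] := choice step.
pose Y k := iter k P (cst y0).
have cY k : continuous (Y k).
  elim: k => [|k IH] t /=; first exact: cst_continuous.
  exact: is_derive1_continuous ((PP _ IH).2 t).
have Y0 k : Y k 0 = y0 by case: k => [|k]//=; exact: (PP _ (cY k)).1.
have dY k (t : R) : is_derive t 1 (Y k.+1) (f (Y k t)) by exact: (PP _ (cY k)).2.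
(* The first increment has derivative [f y0], of norm at most [|f y0| * w] because [1 <= w];
   integration divides by [K]. *)
pose M := `|f y0| / K.
have M0 : 0 <= M by rewrite divr_ge0// ltW.
have YM k t : `|Y k.+1 t - Y k t| <= M * w t * 2^-1 ^+ k.
  elim: k t => [|k IH] t.
    rewrite expr0 mulr1 -mulrAC -mulrA.
    apply: (cmp (Y 1%N - Y 0%N) (fun t => f y0 - 0)) => //.
    - by rewrite !fctE !Y0 subrr.
    - by move=> s; rewrite subr0 ler_peMr.
  rewrite (_ : _ * _ * _ = (L * M * 2^-1 ^+ k) * (w t / K)); last first.
    by rewrite exprS /K; field; rewrite gt_eqF.
  apply: (cmp (Y k.+2 - Y k.+1) (fun t => f (Y k.+1 t) - f (Y k t))) => //.
  - by rewrite !fctE !Y0 subrr.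
  - by rewrite mulr_ge0 ?exprn_ge0// mulr_ge0// ltW.
  - move=> s; rewrite (le_trans (fL _ _))// -!mulrA ler_pM2l//.
    by rewrite (le_trans (IH s))// mulrA mulrAC -mulrA.
have [y yP] := choice (fun t => ex_geometric_limit (fun k => Y k t) (M * w t) (YM^~ t)).
have cw : continuous w.
  move=> t; apply: (@continuousD _ _ _ (fun t => expR (K * t)) (fun t => expR (- K * t)));
  exact: is_derive1_continuous (dexp _ t).
have cy : continuous y.
  move=> t; apply/cvgrPdist_le => e e0.
  have [k kP] := ex_geometric_lt (2 * (M * (w t + 1))) (e / 3) (divr_gt0 e0 (ltr0Sn _ _)).
  (* Convergence is uniform where [w <= w t + 1], which is a neighbourhood of [t]. *)
  have Bk s : w s <= w t + 1 -> `|y s - Y k s| <= e / 3.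
    move=> ws; rewrite (le_trans (yP s k))// (le_trans _ (ltW kP))//.
    by rewrite ler_wpM2r ?exprn_ge0// ler_wpM2l// ler_wpM2l.
  near=> s.
  have /Bk A : w s <= w t + 1.
    by near: s; apply: cvgr_le (cw t) _ _; rewrite ltrDl.
  have /Bk B : w t <= w t + 1 by rewrite lerDl.
  have C : `|Y k t - Y k s| <= e / 3.
    by near: s; apply: cvgr_dist_le (cY k t) _ _; rewrite divr_gt0.
  rewrite distrC in A.
  have := ler_distD (Y k t) (y t) (y s); have := ler_distD (Y k s) (Y k t) (y s); lra.
(* The limit is not differentiated directly: the primitive [Z] of [f \o y] and [y] itself both lie
   within [M * w t * 2^-1 ^+ k] of [Y k.+1 t], so they coincide. *)
have [Z Z0 dZ] := ex_antiderivative_cV (f \o y) y0 (fun t => continuous_comp (cy t) (cf (y t))).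
suff Zy : Z = y by exists y; rewrite -?Zy// => t; rewrite {2}Zy; exact: dZ.
apply/funext => t; apply/eqP; rewrite -subr_eq0 -normr_eq0; apply/eqP.
apply/eqP; rewrite eq_le normr_ge0 andbT; apply/ler_addgt0Pr => e e0; rewrite add0r.
have [k /ltW kP] := ex_geometric_lt (2 * (M * w t)) e e0; apply: le_trans kP.
have A : `|Z t - Y k.+1 t| <= (2 * L * M * 2^-1 ^+ k) * (w t / K).
  apply: (cmp (Z - Y k.+1) (fun t => f (y t) - f (Y k t))) => //.
  - by rewrite !fctE Z0 Y0 subrr.
  - by rewrite mulr_ge0 ?exprn_ge0// mulr_ge0// mulr_ge0// ltW.
  - move=> s; rewrite (le_trans (fL _ _))//.
    have := yP s k; rewrite -(ler_pM2l L0) => /le_trans; apply.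
    by rewrite le_eqVlt; apply/orP; left; apply/eqP; ring.
have {A}A : `|Z t - Y k.+1 t| <= M * w t * 2^-1 ^+ k.
  apply: le_trans A _; rewrite le_eqVlt; apply/orP; left; apply/eqP.
  by rewrite /K; field; rewrite gt_eqF.
have B := yP t k.+1; rewrite distrC exprS in B.
by have := ler_distD (Y k.+1 t) (Z t) (y t); lra.
Unshelve. all: by end_near. Qed.

(** * Partial derivatives and homogeneous maps *)

Lemma is_derive_line {R : realType} {V W : normedModType R} (f : V ->
    W) (z e : V) (t : R) (df : W) :
  is_derive (z + t *: e) e f df -> is_derive t 1 (fun s : R => f (z + s *: e)) df.
Proof.
move=> [fd fE].
have E : (fun h : R => h^-1 *: (f (z + (h *: 1 + t) *: e) - f (z + t *: e))) =
    (fun h : R => h^-1 *: (f (h *: e + (z + t *: e)) - f (z + t *: e))).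
  by apply/funext => h; rewrite [h *: 1]mulr1 scalerDl addrCA.
by apply: DeriveDef; [rewrite /derivable /= E|rewrite /derive /= E].
Qed.

(** The mean value theorem is applied to each entry, with its own intermediate point; in the maximum
    norm this loses no factor. *)
Lemma norm_increment_le {R : realType} {V : normedModType R} {n : nat} (f : V -> 'cV[R]_n)
    (z e : V) (s C : R) :
  (forall t : R, 0 <= t <= 1 ->
    derivable f (z + (t * s) *: e) e /\ `|'D_e f (z + (t * s) *: e)| <= C) ->
  `|f (z + s *: e) - f z| <= C * `|s|.
Proof.
move=> fC.
have C0 : 0 <= C.
  by have := fC 0; rewrite lexx ler01 => /(_ isT)[_]; exact: le_trans.
apply: mx_norm_le => [|i j]; first by rewrite mulr_ge0.
pose phi (t : R) := f (z + (t * s) *: e) i j.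
have dphi (t : R) : 0 <= t <= 1 -> is_derive t 1 phi ('D_e f (z + (t * s) *: e) i j * s).
  move=> t01.
  apply: (@is_derive1_comp _ (fun t => f (z + t *: e) i j) (fun t => t * s)).
    apply: (@is_derive_line _ _ _ (fun w => f w i j)).
    apply: (is_derive_mx f _ _ _).1.
    by apply: DeriveDef => //; case: (fC t t01).
  rewrite (_ : (fun t => t * s) = s *: id); last by apply/funext => x; rewrite mulrC.
  by rewrite -[X in is_derive _ _ _ X]mulr1; exact: is_deriveZ.
have [x||c c01] :=  @MVT_segment R phi
  (fun t => 'D_e f (z + (t * s) *: e) i j * s) 0 1 ler01.
- by rewrite in_itv/= => /andP[x0 x1]; apply: dphi; rewrite (ltW x0) (ltW x1).
- apply: continuous_in_subspaceT => y; rewrite inE /= in_itv/= => y01.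
  exact: is_derive1_continuous (dphi y y01).
rewrite /phi mul1r mul0r scale0r addr0 subr0 mulr1 mxE mxE => ->.
rewrite normrM ler_wpM2r// (le_trans (le_mx_entry _ _ _))//.
by apply: (fC c _).2; move: c01; rewrite in_itv.
Qed.

(** The path from [x] to [y] changes one coordinate at a time, each of the [n] legs costing at most
    [C * |y - x|]. The closure condition on [D], true of maximum-norm balls, keeps the corners
    inside. *)
Lemma norm_sub_coord_le {R : realType} {n : nat} {W : normedModType R} (D : set 'cV[R]_n)
    (f : 'cV[R]_n -> W) (C : R) : 0 <= C ->
  (forall x y z : 'cV[R]_n, D x -> D y -> (forall i, z i 0 = x i 0 \/ z i 0 = y i 0) -> D z) ->
  (forall (z : 'cV[R]_n) i s, D z -> D (z + s *: ei R i) ->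
    `|f (z + s *: ei R i) - f z| <= C * `|s|) ->
  forall x y, D x -> D y -> `|f y - f x| <= n%:R * C * `|y - x|.
Proof.
move=> C0 Dbox fC x y Dx Dy.
pose z (k : nat) : 'cV[R]_n := \col_i if (i < k)%N then y i 0 else x i 0.
have Dz k : D (z k).
  by apply: (Dbox x y) => // i; rewrite mxE; case: ifP; [right|left].
have zn : z n = y by apply/colP => i; rewrite mxE ltn_ord.
have z0 : z 0%N = x by apply/colP => i; rewrite mxE.
have key k : (k <= n)%N -> `|f (z k) - f x| <= k%:R * C * `|y - x|.
  elim: k => [|k IH] kn; first by rewrite z0 subrr normr0 !mul0r.
  pose i := Ordinal kn.
  have zS : z k.+1 = z k + (y i 0 - x i 0) *: ei R i.
    apply/colP => j; rewrite !mxE ltnS leq_eqVlt (_ : (j == k :> nat) = (j == i))//.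
    have [->|] := eqVneq j i; first by rewrite ltnn/= mulr1 addrC subrK.
    by rewrite /= mulr0 addr0.
  have := Dz k.+1; rewrite zS => /(fC _ _ _ (Dz k)) A.
  have B : `|y i 0 - x i 0| <= `|y - x|.
    by have := le_mx_entry (y - x) i 0; rewrite !mxE.
  rewrite (le_trans (ler_distD (f (z k)) _ _))// -natr1 mulrDl mulrDl addrC mul1r lerD//.
    exact/IH/ltnW.
  by rewrite (le_trans A)// ler_wpM2l.
by have := key n (leqnn n); rewrite zn.
Qed.

(** Continuity of the partial derivatives at [v] gives total differentiability: subtracting the
    linear map [J] leaves partial derivatives of size at most [C] near [v]. The denominator
    [n%:R + 1] of [C] makes [n%:R * C <= e] and stays positive when [n = 0]. *)
Lemma derivable_partial_approx {R : realType} {n : nat} (F : 'cV[R]_n ->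
    'cV[R]_n) (v : 'cV[R]_n) :
  (\forall w \near v, forall i, derivable F w (ei R i)) ->
  (forall i, {for v, continuous (fun w => 'D_(ei R i) F w)}) ->
  forall e : R, 0 < e -> exists2 r : R, 0 < r & forall h, `|h| <= r ->
    `|F (v + h) - F v - (\matrix_(i, j) ('D_(ei R j) F v) i 0) *m h| <= e * `|h|.
Proof.
move=> dF cF e e0; set J := \matrix_(i, j) _.
pose C := e / (n%:R + 1).
have n1 : 0 < n%:R + 1 :> R by rewrite ltr_wpDl.
have C0 : 0 < C by rewrite divr_gt0.
have : \forall w \near v, forall i, derivable F w (ei R i) /\
    `|'D_(ei R i) F v - 'D_(ei R i) F w| <= C.
  near=> w => i; split; first by move: i; near: w.
  move: i; near: w; apply: filter_forall => i.
  exact: (cvgrPdist_le _ _).1 (cF i) _ C0.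
move=> /nbhs_normP[r r0 rP]; rewrite /= in rP.
exists (r / 2); first by rewrite divr_gt0.
move=> h hr.
pose G w := F w - J *m w.
have JE j : J *m ei R j = 'D_(ei R j) F v.
  apply/colP => i; rewrite mxE (bigD1 j)//= big1 => [|k kj].
    by rewrite !mxE !eqxx mulr1 addr0.
  by rewrite !mxE (negbTE kj) mulr0.
have dG w i : `|v - w| < r -> is_derive w (ei R i) G ('D_(ei R i) F w - 'D_(ei R i) F v).
  move=> /rP/(_ i)[dFw _]; apply: is_deriveB; first exact: DeriveDef.
  rewrite -JE.
  apply/is_derive_mx => a b.
  rewrite [X in is_derive _ _ X _](_ : _ = \sum_k (fun x : 'cV[R]_n => J a k * x k b));
    last first.
    by apply/funext => x; rewrite mxE fct_sumE.
  rewrite mxE; apply: is_derive_sum => k.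
  have -> : (fun x : 'cV[R]_n => J a k * x k b) = J a k *: (fun x : 'cV[R]_n => x k b) by [].
  apply: is_deriveZ; apply: (is_derive_mx id _ _ _).1; exact: is_derive_id.
pose D : set 'cV[R]_n := [set w | `|v - w| <= r / 2].
have Dr w : D w -> `|v - w| < r by move=> /le_lt_trans; apply;
  rewrite ltr_pdivrMr// ltr_pMr// ltr1n.
have -> : F (v + h) - F v - J *m h = G (v + h) - G v.
  rewrite /G mulmxDr; move: (J *m v) (J *m h) => a b.
  by apply/colP => k; rewrite !mxE; ring.
have : `|G (v + h) - G v| <= n%:R * C * `|v + h - v|.
  apply: (@norm_sub_coord_le _ _ _ D); first exact: ltW.
  - move=> x y z Dx Dy zxy; apply: mx_norm_le => [|i j]; first by rewrite divr_ge0// ltW.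
    rewrite !mxE (ord1 j); case: (zxy i) => ->.
    + by have := le_trans (le_mx_entry _ i 0) Dx; rewrite !mxE.
    + by have := le_trans (le_mx_entry _ i 0) Dy; rewrite !mxE.
  - move=> z i s Dz Dzs; apply: norm_increment_le => t t01.
    have /Dr zr : D (z + (t * s) *: ei R i).
      rewrite /D /= (_ : v - _ = (1 - t) *: (v - z) + t *: (v - (z + s *: ei R i))); last first.
        by apply/colP => k; rewrite !mxE; ring.
      rewrite (le_trans (ler_normD _ _))// !normrZ.
      move: t01 => /andP[t0 t1]; rewrite !ger0_norm ?subr_ge0//.
      have A : (1 - t) * `|v - z| <= (1 - t) * (r / 2) by rewrite ler_wpM2l ?subr_ge0.
      have B : t * `|v - (z + s *: ei R i)| <= t * (r / 2) by rewrite ler_wpM2l.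
      by rewrite (le_trans (lerD A B))// -mulrDl subrK mul1r.
    have [dGz ->] := dG _ i zr; split => //.
    by rewrite distrC; exact: (rP _ zr i).2.
  - by rewrite /D /= subrr normr0 divr_ge0// ltW.
  - by rewrite /D /= opprD addrA subrr sub0r normrN.
rewrite (addrC v h) addrK => /le_trans; apply.
rewrite ler_wpM2r// /C mulrA ler_pdivrMr// mulrDr mulr1 mulrC lerDl; exact: ltW.
Unshelve. all: by end_near. Qed.

Lemma continuous_trmx {R : realType} {m n : nat} : continuous (@trmx R m n).
Proof.
apply: (@continuous_lipschitz _ _ _ _ 1) => x y; rewrite mul1r.
apply: mx_norm_le => // i j; rewrite !mxE.
by have := le_mx_entry (x - y) j i; rewrite !mxE.
Qed.

(** Compactness of the sphere and the extreme value theorem, used for row vectors through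
    transposition. The sphere is empty exactly when [n = 0]. *)
Lemma norm_le_on_unit_sphere {R : realType} {n : nat} {W : normedModType R} (f : 'cV[R]_n -> W) :
  (forall v, v != 0 -> {for v, continuous f}) ->
  exists C : R, forall v, `|v| = 1 -> `|f v| <= C.
Proof.
move=> cf; pose S : set 'rV[R]_n := [set u | `|u^T| = 1].
have [S0|/set0P S0] := eqVneq S set0.
  exists 0 => v v1; have : S v^T by rewrite /S /= trmxK.
  by rewrite S0.
have cn : continuous (fun u : 'rV[R]_n => `|u^T|).
  move=> u; apply: (@continuous_comp _ _ _ (@trmx R 1 n) (fun x => `|x|)).
    exact: continuous_trmx.
  exact: norm_continuous.
have cS : compact S.
  apply: bounded_closed_compact.
    exists 1; split => // M M1 u Su; rewrite -(trmxK u).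
    apply: le_trans (ltW M1); rewrite -Su.
    by apply: mx_norm_le => // i j; rewrite mxE le_mx_entry.
  rewrite (_ : S = (fun u : 'rV[R]_n => `|u^T|) @^-1` [set 1])//.
  by apply: closed_comp => [u _|]; [exact: cn|exact: closed_eq].
have [|c _ cP] := @EVT_max_rV R n (fun u => `|f u^T|) S S0 cS.
  apply: continuous_in_subspaceT => u; rewrite inE => Su.
  apply: (@continuous_comp _ _ _ (f \o @trmx R 1 n) (fun x => `|x|)).
    apply: (@continuous_comp _ _ _ (@trmx R 1 n) f); first exact: continuous_trmx.
    by apply: cf; rewrite -normr_eq0 Su oner_eq0.
  exact: norm_continuous.
exists (`|f c^T|) => v v1.
by have := cP v^T; rewrite trmxK; apply; rewrite inE /S /= trmxK.
Qed.

(** The difference quotient at [a *: v] with increment [h] is the one at [v] with increment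
    [h / a]. *)
Lemma derive_homogeneous {R : realType} {V W : normedModType R} (F : V -> W) (v e : V) (a : R) :
  a != 0 -> (forall (c : R) x, F (c *: x) = c *: F x) -> derivable F v e ->
  'D_e F (a *: v) = 'D_e F v.
Proof.
move=> a0 hF dF; apply/cvg_lim; first exact: norm_hausdorff.
pose q (h : R) := h^-1 *: (F (h *: e + v) - F v).
rewrite [X in X @ _](_ : _ = q \o (fun h => h / a)); last first.
  apply/funext => h /=; rewrite /q invfM invrK -scalerA; congr (_ *: _).
  by rewrite scalerBr -!hF scalerDr scalerA mulrC divfK.
apply: (@cvg_comp _ _ _ (fun h => h / a) q _ (0^')); last exact: dF.
move=> P [r /= r0 rP]; exists (r * `|a|) => /=; first by rewrite mulr_gt0// normr_gt0.
move=> h /= hr h0; apply: rP; last by rewrite mulf_neq0// invr_eq0.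
by move: hr; rewrite /ball_ /= !sub0r !normrN normrM normfV ltr_pdivrMr// normr_gt0.
Qed.

(* On a line through the origin a homogeneous map is linear; every other coordinate line
   avoids the origin, and there the partial derivatives are bounded by 0-homogeneity. *)
Lemma homogeneous_lipschitz {R : realType} {n : nat} (F : 'cV[R]_n -> 'cV[R]_n) :
  (forall (c : R) x, F (c *: x) = c *: F x) ->
  (forall v i, v != 0 -> derivable F v (ei R i)) ->
  (forall v i, v != 0 -> {for v, continuous (fun w => 'D_(ei R i) F w)}) ->
  exists2 L : R, 0 < L & forall x y, `|F x - F y| <= L * `|x - y|.
Proof.
move=> hF dF cF.
have [K KP] := choice (fun i => norm_le_on_unit_sphere _ (cF ^~ i)).
(* [K i] bounds the partial derivatives off the origin, and [|F (ei R i)|] is the slope along the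
   axis through the origin. *)
pose C := \sum_i (`|K i| + `|F (ei R i)|).
have C0 : 0 <= C by apply: sumr_ge0 => i _; rewrite addr_ge0.
have CP i : `|K i| + `|F (ei R i)| <= C.
  by rewrite /C (bigD1 i)//= lerDl sumr_ge0// => j _; rewrite addr_ge0.
have DC v i : v != 0 -> `|'D_(ei R i) F v| <= C.
  move=> v0; have nv0 : `|v| != 0 by rewrite normr_eq0.
  rewrite -(@derive_homogeneous _ _ _ F v _ `|v|^-1) ?invr_eq0//; last exact: dF.
  apply: le_trans (CP i); rewrite ler_wpDr// (le_trans _ (ler_norm _))// KP//.
  by rewrite normrZ normfV normr_id mulVf.
have n1 : 0 < n%:R * C + 1 by rewrite ltr_wpDl// mulr_ge0.
exists (n%:R * C + 1) => // x y.
rewrite (@le_trans _ _ (n%:R * C * `|x - y|))//; last by rewrite ler_wpM2r// lerDl.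
apply: (@norm_sub_coord_le _ _ _ setT) => // z i s _ _.
have [[t zt]|nz] := pselect (exists t : R, z + t *: ei R i = 0).
  have -> : z = (- t) *: ei R i by apply/eqP; rewrite scaleNr -addr_eq0 zt.
  rewrite -scalerDl !hF -scalerBl addrC addKr normrZ mulrC ler_wpM2r//.
  by rewrite (le_trans _ (CP i))// lerDr.
apply: norm_increment_le => t _.
have z0 : z + (t * s) *: ei R i != 0 by apply/eqP => z0; apply: nz; exists (t * s).
by split; [exact: dF|exact: DC].
Qed.

Lemma dotmx_bound {R : realType} {n : nat} (u v : 'cV[R]_n) :
  `|(u^T *m v) 0 0| <= n%:R * (`|u| * `|v|).
Proof.
rewrite mxE (le_trans (ler_norm_sum _ _ _))//.
rewrite (@le_trans _ _ (\sum_(i < n) (`|u| * `|v|)))//; last first.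
  by rewrite sumr_const card_ord mulr_natl.
apply: ler_sum => i _; rewrite mxE normrM; apply: ler_pM => //; exact: le_mx_entry.
Qed.

Lemma sqr_norm_le_dotmx {R : realType} {n : nat} (u : 'cV[R]_n) :
  `|u| ^+ 2 <= (u^T *m u) 0 0.
Proof.
have E : (u^T *m u) 0 0 = \sum_i u i 0 ^+ 2.
  by rewrite mxE; apply: eq_bigr => i _; rewrite mxE expr2.
have [u0|u0] := eqVneq `|u| 0; first by rewrite u0 expr0n/= E sumr_ge0// => i _; exact: sqr_ge0.
have [[i j] /= ui] := mx_norm_neq0 u0.
rewrite [`|u|]ui E (bigD1 i)//= (ord1 j) real_normK ?num_real// lerDl.
by rewrite sumr_ge0// => k _; exact: sqr_ge0.
Qed.

Lemma dotmxC {R : realType} {n : nat} (u v : 'cV[R]_n) : (u^T *m v) 0 0 = (v^T *m u) 0 0.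
Proof. by rewrite -[in RHS](trmxK u) -trmx_mul [RHS]mxE. Qed.

(** The quotient [p] is bounded but need not be Lipschitz near the origin. Only [|p x - p y|] times
    the larger norm is controlled by [|x - y|]; this suffices, as the difference of [p] can be made
    to multiply the shorter vector. *)
Lemma rhs_lipschitz {R : realType} {n : nat} (A : 'cV[R]_n -> 'M[R]_n) (K : R) :
  (forall (c : R) v, c != 0 -> A (c *: v) = A v) -> 0 < K ->
  (forall x y, `|A x *m x - A y *m y| <= K * `|x - y|) ->
  exists2 L : R, 0 < L & forall x y, `|rhs A x - rhs A y| <= L * `|x - y|.
Proof.
move=> hA K0 FK.
pose N : R := n%:R.
have N0 : 0 <= N by [].
have F0 x : `|A x *m x| <= K * `|x| by have := FK x 0; rewrite mulmx0 !subr0.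
pose p := rayleigh A.
have pb y : `|p y| <= N * K.
  rewrite /p /rayleigh; have [->|y0] := eqVneq y 0.
    by rewrite !mulmx0 mxE mul0r normr0 mulr_ge0// ltW.
  have yy : 0 < (y^T *m y) 0 0.
    by rewrite (lt_le_trans _ (sqr_norm_le_dotmx y))// exprn_gt0// normr_gt0.
  rewrite normrM normfV (gtr0_norm yy) ler_pdivrMr//.
  rewrite -mulmxA (le_trans (dotmx_bound _ _))// -mulrA ler_wpM2l//.
  rewrite (le_trans (ler_wpM2l (normr_ge0 _) (F0 y)))//.
  by rewrite mulrCA -expr2 ler_pM2l// sqr_norm_le_dotmx.
have pdiff x y : `|y| <= `|x| -> `|p x - p y| * `|x| <= (4 * N * K + 2 * N * K * N) * `|x - y|.
  move=> yx; have [x0|x0] := eqVneq x 0.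
    rewrite x0 normr0 mulr0 mulr_ge0// addr_ge0// !mulr_ge0// ltW//.
  have nx : 0 < `|x| by rewrite normr_gt0.
  have xx : 0 < (x^T *m x) 0 0.
    by rewrite (lt_le_trans _ (sqr_norm_le_dotmx x))// exprn_gt0.
  (* Multiplying by [x^T x] clears the denominator of [p x]. Adding [p y * y^T y - y^T (A y) y = 0]
     then leaves differences of products, each expanded by the product rule. *)
  have E : (p x - p y) * (x^T *m x) 0 0 =
      ((x - y)^T *m (A x *m x)) 0 0 + (y^T *m (A x *m x - A y *m y)) 0 0
      - p y * (((x - y)^T *m x) 0 0 + (y^T *m (x - y)) 0 0).
    have px : p x * (x^T *m x) 0 0 = (x^T *m (A x *m x)) 0 0.
      by rewrite /p /rayleigh divfK ?gt_eqF// mulmxA.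
    have py : p y * (y^T *m y) 0 0 = (y^T *m (A y *m y)) 0 0.
      have [->|y0] := eqVneq y 0; first by rewrite !mulmx0 !mxE mulr0.
      have yy : 0 < (y^T *m y) 0 0.
        by rewrite (lt_le_trans _ (sqr_norm_le_dotmx y))// exprn_gt0// normr_gt0.
      by rewrite /p /rayleigh divfK ?gt_eqF// mulmxA.
    rewrite mulrBl px linearB/= !mulmxBl !mulmxBr.
    have e (a b : 'M[R]_1) : (a - b) 0 0 = a 0 0 - b 0 0 by rewrite !mxE.
    by rewrite !e; move: py; lra.
  rewrite -(ler_pM2r nx) -[in leLHS]mulrA -expr2.
  rewrite (@le_trans _ _ `|(p x - p y) * (x^T *m x) 0 0|)//.
    by rewrite normrM (gtr0_norm xx) ler_wpM2l// sqr_norm_le_dotmx.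
  have b1 := dotmx_bound (x - y) (A x *m x).
  have b2 := dotmx_bound y (A x *m x - A y *m y).
  have b3 := dotmx_bound (x - y) x.
  have b4 := dotmx_bound y (x - y).
  set d := `|x - y| in b1 b2 b3 b4 *; have d0 : 0 <= d := normr_ge0 _.
  have c1 : `|x - y| * `|A x *m x| <= K * (d * `|x|) by rewrite mulrCA ler_wpM2l.
  have c2 : `|y| * `|A x *m x - A y *m y| <= K * (d * `|x|).
    by rewrite mulrC mulrA ler_pM.
  have c4 : `|y| * d <= d * `|x| by rewrite mulrC ler_wpM2l.
  set a1 := ((x - y)^T *m (A x *m x)) 0 0 in E b1.
  set a2 := (y^T *m (A x *m x - A y *m y)) 0 0 in E b2.
  set a3 := ((x - y)^T *m x) 0 0 in E b3.
  set a4 := (y^T *m (x - y)) 0 0 in E b4.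
  have a1b : `|a1| <= N * (K * (d * `|x|)) by rewrite (le_trans b1)// ler_wpM2l.
  have a2b : `|a2| <= N * (K * (d * `|x|)) by rewrite (le_trans b2)// ler_wpM2l.
  have a4b : `|a4| <= N * (d * `|x|) by rewrite (le_trans b4)// ler_wpM2l.
  have a34 : `|p y * (a3 + a4)| <= N * K * (2 * N * (d * `|x|)).
    rewrite normrM ler_pM//; have := ler_normD a3 a4; have := b3; rewrite -/N; lra.
  rewrite E; have := ler_normB (a1 + a2) (p y * (a3 + a4)); have := ler_normD a1 a2.
  have pos : 0 <= N * (K * (d * `|x|)) by rewrite !mulr_ge0// ltW.
  nra.
pose L := (4 * N * K + 2 * N * K * N) + N * K + K.
have L0 : 0 < L by rewrite ltr_wpDl// !addr_ge0// !mulr_ge0// ltW.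
exists L => //.
have wl x y : `|y| <= `|x| -> `|rhs A x - rhs A y| <= L * `|x - y|.
  move=> yx; rewrite /rhs -/(p x) -/(p y).
  have -> : p x *: x - A x *m x - (p y *: y - A y *m y) =
      (p x - p y) *: y + p x *: (x - y) - (A x *m x - A y *m y).
    by rewrite scalerBl scalerBr; move: (p x *: x) (p x *: y) (p y *: y) (A x *m x) (A y *m y)
       => a b c e f; apply/colP => i; rewrite !mxE; ring.
  rewrite (le_trans (ler_normB _ _))// /L [leRHS]mulrDl lerD//.
  rewrite (le_trans (ler_normD _ _))// [leRHS]mulrDl !normrZ lerD//.
    by rewrite (le_trans _ (pdiff _ _ yx))// ler_wpM2l.
  by rewrite -normrM; apply: ler_wpM2r; [exact: normr_ge0|exact: pb].
move=> x y; have [xy|/ltW yx] := leP `|x| `|y|; last exact: wl.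
by rewrite distrC (distrC x); exact: wl.
Qed.

Lemma continuous_mulmx_for {R : realType} {T : topologicalType} {m p q : nat}
    (f : T -> 'M[R]_(m, p)) (g : T -> 'M[R]_(p, q)) (t : T) :
  {for t, continuous f} -> {for t, continuous g} -> {for t, continuous (fun x => f x *m g x)}.
Proof.
move=> cf cg; apply: continuous_mx => i j.
rewrite (_ : (fun x => _) = (fun x => \sum_k f x i k * g x k j)); last first.
  by apply/funext => x; rewrite mxE.
elim: (index_enum _) => [|k r IH].
  rewrite (_ : (fun x => _) = cst 0); first exact: cst_continuous.
  by apply/funext => x; rewrite big_nil.
rewrite (_ : (fun x => _) = (fun x => f x i k * g x k j + \sum_(k <- r) f x i k * g x k j));
  last first.
  by apply/funext => x; rewrite big_cons.
apply: (@continuousD _ _ _ (fun x => f x i k * g x k j)) => //.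
apply: (@continuousM _ _ (fun x => f x i k) (fun x => g x k j)).
- apply: (@continuous_comp _ _ _ f (fun M : 'M[R]_(m, p) => M i k)) => //.
  exact: coord_continuous.
- apply: (@continuous_comp _ _ _ g (fun M : 'M[R]_(p, q) => M k j)) => //.
  exact: coord_continuous.
Qed.

Lemma is_derive_mulmx_id {R : realType} {n : nat} (A : 'cV[R]_n -> 'M[R]_n) (v e : 'cV[R]_n) :
  derivable A v e -> is_derive v e (fun w => A w *m w) ('D_e A v *m v + A v *m e).
Proof.
move=> dA; apply/is_derive_mx => i j.
rewrite (_ : (fun x => _) = \sum_k ((fun w => A w i k) * (fun w : 'cV[R]_n => w k j)));
  last first.
  by apply/funext => x; rewrite mxE fct_sumE.
rewrite !mxE -big_split /=; apply: is_derive_sum => k.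
have dAik : is_derive v e (fun w => A w i k) ('D_e A v i k).
  by apply: (is_derive_mx A _ _ _).1; exact: DeriveDef.
have dk : is_derive v e (fun w : 'cV[R]_n => w k j) (e k j).
  by apply: (is_derive_mx id _ _ _).1; exact: is_derive_id.
rewrite (_ : _ + _ = A v i k *: e k j + v k j *: 'D_e A v i k).
  exact: (is_deriveM dAik dk).
by rewrite addrC /GRing.scale/= (mulrC (v k j)).
Qed.

Lemma near_neq0 {R : realType} {V : normedModType R} (v : V) : v != 0 ->
    \forall w \near v, w != 0.
Proof.
move=> v0; near=> w; apply/eqP => w0.
have : `|v - w| < `|v|.
  by near: w; apply: (@cvgr_dist_lt _ _ _ _ _ id v); [exact: cvg_id|rewrite normr_gt0].
by rewrite w0 subr0 ltxx.
Unshelve. all: by end_near. Qed.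

Lemma Ck_nz_mulmx_id {R : realType} {n : nat} (A : 'cV[R]_n ->
    'M[R]_n) (k : nat) (v : 'cV[R]_n) i :
  Ck_nz k.+2 A -> v != 0 ->
  derivable (fun w => A w *m w) v (ei R i) /\
  {for v, continuous (fun w => 'D_(ei R i) (fun w => A w *m w) w)}.
Proof.
move=> [cA [dA /(_ i)[cDA _]]] v0.
have dF w : w != 0 -> is_derive w (ei R i) (fun w => A w *m w) ('D_(ei R i) A w *m w + A w *m ei
  R i).
  by move=> w0; apply: is_derive_mulmx_id; exact: dA.
split; first by case: (dF v v0).
have E : \forall w \near v, 'D_(ei R i) A w *m w + A w *m ei R i =
    'D_(ei R i) (fun w => A w *m w) w.
  by apply: filterS (near_neq0 v v0) => w /dF[_ ->].
suff cG : {for v, continuous (fun w => 'D_(ei R i) A w *m w + A w *m ei R i)}.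
  have Ev := nbhs_singleton E; rewrite /= in Ev.
  apply: (cvg_trans (near_eq_cvg E)); rewrite /= -Ev; exact: cG.
apply: (@continuousD _ _ _ (fun w => 'D_(ei R i) A w *m w) (fun w => A w *m ei R i)).
- by apply: (@continuous_mulmx_for _ _ _ _ _ _ id); [exact: cDA|].
- by apply: (@continuous_mulmx_for _ _ _ _ _ A (cst (ei R i))); [exact: cA|exact: cst_continuous].
Qed.

(** * Quadratic Lyapunov forms *)

(** The complex Schur form [P M = T P] split into real and imaginary parts, with [T] lower
    triangular, so that later estimates stay in [R]. The second clause is the real part of unitarity
    and gives [|P x| = |x|] in the Euclidean norm for real [x]. *)
Lemma real_schur {R : realType} {n : nat} (M : 'M[R]_n) : (0 < n)%N ->
  exists P1 P2 T1 T2 : 'M[R]_n,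
    [/\ P1 *m M = T1 *m P1 - T2 *m P2 /\ P2 *m M = T1 *m P2 + T2 *m P1,
        P1^T *m P1 + P2^T *m P2 = 1%:M,
        forall i j : 'I_n, (i < j)%N -> T1 i j = 0 /\ T2 i j = 0 &
        forall i, spectrum M (Complex (T1 i i) (T2 i i))].
Proof.
move=> n0; have [P Pu Ptrig] := Schur (cmx M) n0.
have Punit := unitarymx_unit Pu.
have [T PM Ttrig] : exists2 T, P *m cmx M = T *m P & is_trig_mx T.
  exists (P *m cmx M *m invmx P); first by rewrite mulmxKV.
  by move: Ptrig; rewrite /similar_to /= conjumx.
pose re (X : 'M[R[i]]_n) : 'M[R]_n := \matrix_(i, j) complex.Re (X i j).
pose im (X : 'M[R[i]]_n) : 'M[R]_n := \matrix_(i, j) complex.Im (X i j).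
have reM (a b : R[i]) : complex.Re (a * b) = complex.Re a * complex.Re b - complex.Im a *
  complex.Im b.
  by case: a b => [a a'] [b b'].
have imM (a b : R[i]) : complex.Im (a * b) = complex.Re a * complex.Im b + complex.Im a *
  complex.Re b.
  by case: a b => [a a'] [b b'].
exists (re P), (im P), (re T), (im T); split.
- split; apply/matrixP => i j.
  + have := congr1 (fun X : 'M[R[i]]_n => complex.Re (X i j)) PM.
    rewrite !mxE !raddf_sum /= -big_split /= => E.
    rewrite -[RHS](_ : \sum_k complex.Re (T i k * P k j) = _).
      by rewrite -E; apply: eq_bigr => k _; rewrite !mxE reM /= mulr0 subr0.
    by apply: eq_bigr => k _; rewrite !mxE reM.
  + have := congr1 (fun X : 'M[R[i]]_n => complex.Im (X i j)) PM.
    rewrite !mxE !raddf_sum /= -big_split /= => E.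
    rewrite -[RHS](_ : \sum_k complex.Im (T i k * P k j) = _).
      by rewrite -E; apply: eq_bigr => k _; rewrite !mxE imM /= mulr0 add0r.
    by apply: eq_bigr => k _; rewrite !mxE imM.
- have PP := mulVmx Punit; rewrite invmx_unitary// in PP. apply/matrixP => i j.
  have := congr1 (fun X : 'M[R[i]]_n => complex.Re (X i j)) PP.
  rewrite !mxE !raddf_sum /= -big_split /= => E.
  rewrite (_ : (i == j)%:R = complex.Re ((i == j)%:R)); last by case: (i == j).
  rewrite -E; apply: eq_bigr => k _; rewrite !mxE reM.
  by case: (P k i) => a b /=; rewrite mulNr opprK.
- move=> i j ij; rewrite !mxE.
  by have /is_trig_mxP/(_ i j ij) -> := Ttrig.
- move=> i; rewrite /spectrum.
  have -> : Complex (re T i i) (im T i i) = T i i by rewrite !mxE; case: (T i i).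
  have : eigenvalue T (T i i).
    rewrite eigenvalue_root_char char_poly_trig//.
    by rewrite rootE horner_prod (bigD1 i)//= hornerXsubC subrr mul0r.
  move=> /eigenvalueP[v vT v0]; apply/eigenvalueP; exists (v *m P).
    by rewrite -mulmxA PM mulmxA vT scalemxAl.
  apply: contra v0 => /eqP vP0.
  by rewrite -(mulmxK Punit v) vP0 mul0mx.
Qed.

Lemma ex_pos_lower_bound {R : realType} {n : nat} (f : 'I_n -> R) :
  (forall i, 0 < f i) -> exists2 c, 0 < c & forall i, c <= f i.
Proof.
move=> f0; exists (\big[Num.min/1]_i f i); last by move=> i; exact: (bigmin_le 1 i f).
by apply/bigmin_gtP; split.
Qed.

Lemma dotmx_diag {R : realType} {n : nat} (d : 'rV[R]_n) (u v : 'cV[R]_n) :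
  (u^T *m diag_mx d *m v) 0 0 = \sum_i d 0 i * (u i 0 * v i 0).
Proof.
rewrite mxE; apply: eq_bigr => i _; rewrite mul_mx_diag !mxE; ring.
Qed.

(* In Schur coordinates [z = P x] the form is [\sum_i s_i eta^(2i) |z_i|^2] with [s_i] the sign
   of [Re (T i i) - beta]; the weights make the strictly triangular part of [T] negligible. *)
Lemma ex_lyapunov_form {R : realType} {n : nat} (M : 'M[R]_n) (beta : R) : (0 < n)%N ->
  (forall mu, spectrum M mu -> complex.Re mu != beta) ->
  exists2 S : 'M[R]_n, S^T = S & exists2 c : R, 0 < c &
    (forall x : 'cV[R]_n, c * (x^T *m x) 0 0 <=
       (x^T *m S *m (M *m x)) 0 0 - beta * (x^T *m S *m x) 0 0) /\
    ((forall mu, spectrum M mu -> complex.Re mu < beta) ->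
       forall x : 'cV[R]_n, c * (x^T *m x) 0 0 <= - (x^T *m S *m x) 0 0).
Proof.
move=> n0 Mbeta; have [P1 [P2 [T1 [T2 [[PM1 PM2] P12 Ttrig Tspec]]]]] := real_schur M n0.
have [c0 c00 c0P] : exists2 c, 0 < c & forall i, c <= `|T1 i i - beta|.
  apply: ex_pos_lower_bound => i; rewrite normr_gt0 subr_eq0.
  exact: Mbeta _ (Tspec i).
pose K := `|T1| + `|T2|.
have K0 : 0 <= K by rewrite addr_ge0.
have KP i j : `|T1 i j| + `|T2 i j| <= K by rewrite lerD// le_mx_entry.
(* Chosen for [etaK]: the off-diagonal terms sum to at most [2 * n%:R * (eta * K)] times the sum of
   the [b x i], hence use up at most half of the gap [c0]. *)
pose eta := c0 / (c0 + 4 * n%:R * K).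
have den0 : 0 < c0 + 4 * n%:R * K by rewrite ltr_wpDr// !mulr_ge0.
have eta0 : 0 < eta by rewrite divr_gt0.
have eta1 : eta <= 1 by rewrite ler_pdivrMr// mul1r lerDl !mulr_ge0.
have etaK : 2 * n%:R * (eta * K) <= c0 / 2.
  rewrite -subr_ge0.
  have -> : c0 / 2 - 2 * n%:R * (eta * K) = c0 * c0 / 2 / (c0 + 4 * n%:R * K).
    by rewrite /eta; field; rewrite gt_eqF.
  by rewrite !divr_ge0// ?mulr_ge0// ltW.
pose u (i : 'I_n) := eta ^+ i.
have u0 i : 0 < u i by rewrite exprn_gt0.
pose s i : R := if T1 i i < beta then -1 else 1.
have ns i : `|s i| = 1 by rewrite /s; case: ifP => _; rewrite ?normrN normr1.
have sT i : s i * (T1 i i - beta) = `|T1 i i - beta|.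
  rewrite /s; case: ltP => h.
    by rewrite ltr0_norm ?subr_lt0// mulN1r.
  by rewrite ger0_norm ?subr_ge0// mul1r.
pose d : 'rV[R]_n := \row_i (s i * u i ^+ 2).
pose S := P1^T *m diag_mx d *m P1 + P2^T *m diag_mx d *m P2.
have SE (x y : 'cV[R]_n) : (x^T *m S *m y) 0 0 =
    \sum_i s i * u i ^+ 2 * ((P1 *m x) i 0 * (P1 *m y) i 0 + (P2 *m x) i 0 * (P2 *m y) i 0).
  rewrite /S mulmxDr mulmxDl mxE.
  have e (P : 'M[R]_n) : x^T *m (P^T *m diag_mx d *m P) *m y = (P *m x)^T *m diag_mx d *m (P *m
    y).
    by rewrite trmx_mul !mulmxA.
  rewrite !e !dotmx_diag -big_split /=; apply: eq_bigr => i _.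
  by rewrite !mxE; ring.
exists S.
  by rewrite /S linearD /= !trmx_mul !trmxK tr_diag_mx !mulmxA.
pose em := eta ^+ (2 * n).
have em0 : 0 < em by rewrite exprn_gt0.
have emu i : em <= u i ^+ 2.
  rewrite /u -exprM /em ler_wiXn2l// ?(ltW eta0)// mulnC leq_mul2l /=.
  exact/ltnW.
pose b (x : 'cV[R]_n) i := u i ^+ 2 * ((P1 *m x) i 0 ^+ 2 + (P2 *m x) i 0 ^+ 2).
have b0 x i : 0 <= b x i by rewrite mulr_ge0// ?addr_ge0// sqr_ge0.
have sumb x : em * (x^T *m x) 0 0 <= \sum_i b x i.
  have -> : x^T *m x = (P1 *m x)^T *m (P1 *m x) + (P2 *m x)^T *m (P2 *m x).
    rewrite !trmx_mul !mulmxA -!(mulmxA x^T) -mulmxDr -mulmxDl P12.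
    by rewrite mul1mx.
  rewrite !mxE -big_split /= mulr_sumr; apply: ler_sum => i _.
  by rewrite !mxE -!expr2 /b ![(_ *m x) i 0]mxE ler_wpM2r// addr_ge0// sqr_ge0.
(* The [1] serves the definiteness claim and [c0 / 2] the derivative claim; [em] is a lower bound
   for all squared weights. *)
exists (Num.min 1 (c0 / 2) * em).
  by rewrite mulr_gt0// lt_min ltr01 divr_gt0.
(* If every eigenvalue lies to the left of [beta], all signs are [-1] and the negated form is the
   sum of the [b x i]. *)
split=> [x|Mlt x]; last first.
  rewrite SE -sumrN -mulrA (le_trans (ler_wpM2l _ (sumb x)))//.
    by rewrite le_min ler01 divr_ge0// ltW.
  rewrite (@le_trans _ _ (\sum_i b x i))//.
    by rewrite ler_piMl ?sumr_ge0// ge_min lexx.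
  apply: ler_sum => i _; rewrite /s (Mlt _ (Tspec i)) /b -!expr2; lra.
rewrite -mulrA (le_trans (ler_wpM2l _ (sumb x)))//.
  by rewrite le_min ler01 divr_ge0// ltW.
rewrite (@le_trans _ _ (c0 / 2 * \sum_i b x i))//.
  by rewrite ler_wpM2r ?sumr_ge0// ge_min lexx orbT.
rewrite !SE !mulmxA PM1 PM2 mulmxBl mulmxDl -!mulmxA.
set p := P1 *m x; set q := P2 *m x.
have bE i : b x i = u i ^+ 2 * (p i 0 ^+ 2 + q i 0 ^+ 2) by [].
clearbody p q.
pose e i j := p i 0 * (T1 i j * p j 0 - T2 i j * q j 0) + q i 0 * (T1 i j * q j 0 + T2 i j * p j
  0).
have off i j : j != i -> - (eta * K * (b x i + b x j)) <= s i * u i ^+ 2 * e i j.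
  move=> ji; have bb : 0 <= eta * K * (b x i + b x j).
    by apply: mulr_ge0; [exact: mulr_ge0 (ltW eta0) K0|exact: addr_ge0].
  have [ij|ij] := ltnP i j.
    have [t1 t2] := Ttrig i j ij.
    by rewrite /e t1 t2 !mul0r subrr addr0 !mulr0 addr0 mulr0 oppr_le0.
  have {ij}ji : (j < i)%N by rewrite ltn_neqAle val_eqE ji.
  pose a k := u k * (`|p k 0| + `|q k 0|).
  have a0 k : 0 <= a k by rewrite mulr_ge0// ?addr_ge0// ltW.
  have ab k : a k ^+ 2 <= 2 * b x k.
    rewrite /a exprMn bE [leRHS]mulrCA ler_wpM2l ?sqr_ge0//.
    rewrite -(real_normK (num_real (p k 0))) -(real_normK (num_real (q k 0))).
    have := sqr_ge0 (`|p k 0| - `|q k 0|); nra.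
  have eb : `|e i j| <= K * ((`|p i 0| + `|q i 0|) * (`|p j 0| + `|q j 0|)).
    have h1 : `|T1 i j * p j 0 - T2 i j * q j 0| <= `|T1 i j| * `|p j 0| + `|T2 i j| * `|q j 0|.
      by rewrite -!normrM ler_normB.
    have h2 : `|T1 i j * q j 0 + T2 i j * p j 0| <= `|T1 i j| * `|q j 0| + `|T2 i j| * `|p j 0|.
      by rewrite -!normrM ler_normD.
    rewrite (@le_trans _ _ ((`|T1 i j| + `|T2 i j|) * ((`|p i 0| + `|q i 0|) * (`|p j 0| + `|q j
      0|))))//; last first.
      by rewrite ler_wpM2r// mulr_ge0// addr_ge0.
    rewrite /e (le_trans (ler_normD _ _))// 2!normrM.
    have g1 := ler_wpM2l (normr_ge0 (p i 0)) h1.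
    have g2 := ler_wpM2l (normr_ge0 (q i 0)) h2.
    rewrite (le_trans (lerD g1 g2))//.
    have m (x1 x2 x3 : R) : 0 <= `|x1| * (`|x2| * `|x3|) by rewrite !mulr_ge0.
    have := m (T1 i j) (p i 0) (q j 0); have := m (T1 i j) (q i 0) (p j 0).
    have := m (T2 i j) (p i 0) (p j 0); have := m (T2 i j) (q i 0) (q j 0); lra.
  (* As [j < i], the exponent of [eta] in [u i] exceeds that in [u j] by at least one; this is where
     the factor [eta] is gained. *)
  have uu : u i ^+ 2 <= eta * (u i * u j).
    rewrite expr2 [leRHS]mulrCA ler_wpM2l ?(ltW (u0 _))// /u -exprS ler_wiXn2l//.
    exact: ltW.
  have main : `|s i * u i ^+ 2 * e i j| <= eta * K * (b x i + b x j).
    rewrite 2!normrM ns mul1r (ger0_norm (sqr_ge0 _)).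
    rewrite (le_trans (ler_pM (sqr_ge0 _) (normr_ge0 _) uu eb))//.
    rewrite [leLHS](_ : _ = eta * K * (a i * a j)); last by rewrite /a; ring.
    apply: ler_wpM2l; first exact: mulr_ge0 (ltW eta0) K0.
    have := ab i; have := ab j; have := sqr_ge0 (a i - a j); nra.
  by move: main; rewrite ler_norml => /andP[].
have row i : c0 * b x i - \sum_j eta * K * (b x i + b x j) <=
    s i * u i ^+ 2 * (p i 0 * (T1 *m p - T2 *m q) i 0 + q i 0 * (T1 *m q + T2 *m p) i 0)
    - beta * (s i * u i ^+ 2 * (p i 0 * p i 0 + q i 0 * q i 0)).
  have -> : p i 0 * (T1 *m p - T2 *m q) i 0 + q i 0 * (T1 *m q + T2 *m p) i 0 = \sum_j e i j.
    rewrite !mxE -sumrB -big_split /= !mulr_sumr -big_split /=.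
    by apply: eq_bigr => j _; rewrite /e.
  rewrite mulr_sumr (bigD1 i)//= [X in _ <= X - _](bigD1 i)//=.
  have diag : c0 * b x i <= s i * u i ^+ 2 * e i i - beta * (s i * u i ^+ 2 * (p i 0 * p i 0 + q
    i 0 * q i 0)).
    rewrite [leRHS](_ : _ = s i * (T1 i i - beta) * b x i); last by rewrite /e bE; ring.
    by rewrite sT ler_wpM2r.
  have offs : - \sum_(j | j != i) eta * K * (b x i + b x j) <= \sum_(j | j != i) s i * u i ^+ 2 *
    e i j.
    by rewrite -sumrN; apply: ler_sum => j; exact: off.
  have nn : 0 <= eta * K * (b x i + b x i) by apply: mulr_ge0;
    [exact: mulr_ge0 (ltW eta0) K0|exact: addr_ge0].
  lra.
rewrite [beta * _]mulr_sumr -sumrB.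
apply: le_trans (ler_sum _ (fun i _ => row i)).
rewrite sumrB -mulr_sumr.
have -> : \sum_i \sum_j eta * K * (b x i + b x j) = 2 * n%:R * (eta * K) * \sum_i b x i.
  under eq_bigr do rewrite -mulr_sumr big_split /= sumr_const card_ord.
  rewrite -mulr_sumr big_split /= sumr_const card_ord sumrMnl -(mulr_natl (\sum_i b x i)).
  ring.
have sb : 0 <= \sum_i b x i by exact: sumr_ge0.
have := ler_wpM2r sb etaK; lra.
Qed.

(** * The spectrum of the linearization *)

(** Stated over any field because the dynamics uses it over [R] and the spectrum over [R[i]]. A
    plain transpose is enough there, since the embedded [y] has real entries. *)
Definition deflation {F : fieldType} {n : nat} (J : 'M[F]_n) (y : 'cV[F]_n) (lam : F) : 'M[F]_n :=
  - ((1%:M - y *m y^T) *m (J - lam%:M)) - y *m y^T.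

(** From the left, a vector that kills [y] passes unchanged through [1 - y y^T]. This is why
    eigenvalues are transported by row eigenvectors. *)
Lemma deflation_annihilator {F : fieldType} {n : nat} (J : 'M[F]_n) (y : 'cV[F]_n) (lam : F) (u :
    'rV[F]_n) :
  u *m y = 0 -> u *m deflation J y lam = lam *: u - u *m J.
Proof.
move=> uy; rewrite /deflation mulmxDr !mulmxN !mulmxA uy mul0mx oppr0 addr0.
by rewrite [u *m (_ - _)]mulmxBr mulmx1 !mulmxA uy mul0mx subr0 mulmxBr mul_mx_scalar opprB.
Qed.

(** The deflation sends [y] to [- y], so evaluating [u *m deflation J y lam *m y] in two ways gives
    [(nu + 1) u y = 0]: a row eigenvector for [nu != -1] kills [y]. *)
Lemma eigenvalue_deflation {F : fieldType} {n : nat} (J : 'M[F]_n) (y : 'cV[F]_n) (lam nu : F) :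
  y^T *m y = 1%:M -> J *m y = lam *: y -> nu != -1 ->
  eigenvalue (deflation J y lam) nu -> eigenvalue J (lam - nu).
Proof.
move=> yy Jy nu1 /eigenvalueP[u uM u0]; apply/eigenvalueP; exists u => //.
have My : deflation J y lam *m y = - y.
  have By : (J - lam%:M) *m y = 0 by rewrite mulmxBl Jy mul_scalar_mx subrr.
  by rewrite /deflation [LHS]mulmxBl mulNmx -!mulmxA By yy mulmx0 mulmx1 oppr0 add0r.
have uy : u *m y = 0.
  have : u *m deflation J y lam *m y = - (u *m y) by rewrite -mulmxA My mulmxN.
  rewrite uM -scalemxAl => /eqP; rewrite -subr_eq0 opprK -{2}[u *m y]scale1r -scalerDl scaler_eq0.
  by rewrite addr_eq0 (negbTE nu1) => /eqP.
by move: uM; rewrite deflation_annihilator// => /eqP;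
  rewrite subr_eq addrC -subr_eq -scalerBl => /eqP <-.
Qed.

(** Here [u *m J *m y] in two ways gives [(mu - lam) u y = 0], so that [u] kills [y]. *)
Lemma deflation_eigenvalue {F : fieldType} {n : nat} (J : 'M[F]_n) (y : 'cV[F]_n) (lam mu : F) :
  J *m y = lam *: y -> mu != lam -> eigenvalue J mu -> eigenvalue (deflation J y lam) (lam - mu).
Proof.
move=> Jy mulam /eigenvalueP[u uJ u0]; apply/eigenvalueP; exists u => //.
have uy : u *m y = 0.
  have : u *m J *m y = lam *: (u *m y) by rewrite -mulmxA Jy scalemxAr.
  rewrite uJ -scalemxAl => /eqP; rewrite -subr_eq0 -scalerBl scaler_eq0 subr_eq0.
  by rewrite (negbTE mulam) => /eqP.
by rewrite deflation_annihilator// uJ scalerBl.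
Qed.

(* As [(X - J) ((X - lam) - N) = (X - lam) (X - J - N)] for [N = y *m w], a zero eigenvalue of the
   deflation makes [(X - lam) ^+ n] divide the characteristic polynomial of [N + lam],
     so [N] would
   have trace 0, whereas its trace is [w *m y = 1]. *)
Lemma deflation_simple {F : fieldType} {n : nat} (J : 'M[F]_n) (y : 'cV[F]_n) (lam : F) :
  (0 < n)%N -> y^T *m y = 1%:M -> J *m y = lam *: y -> mup lam (char_poly J) = 1%N ->
  ~~ eigenvalue (deflation J y lam) 0.
Proof.
move=> n0 yy Jy mu1; apply/negP => ev0.
pose w := y^T - y^T *m (J - lam%:M).
pose N := y *m w.
have wy : w *m y = 1%:M.
  by rewrite /w mulmxBl yy -mulmxA mulmxBl Jy mul_scalar_mx subrr mulmx0 subr0.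
have ME : deflation J y lam = lam%:M - (J + N).
  rewrite /deflation /N /w [(1%:M - _) *m _]mulmxBl mul1mx [y *m (_ - _)]mulmxBr mulmxA.
  move: (y *m y^T *m (J - lam%:M)) (y *m y^T) => Z Y.
  by apply/matrixP => i j; rewrite !mxE; ring.
have root0 : root (char_poly (J + N)) lam.
  rewrite -eigenvalue_root_char; case/eigenvalueP: ev0 => u uM u0.
  apply/eigenvalueP; exists u => //; move: uM.
  by rewrite ME mulmxBr mul_mx_scalar scale0r => /eqP; rewrite subr_eq0 => /eqP.
have key : char_poly J * char_poly (N + lam%:M) = ('X - lam%:P) ^+ n * char_poly (J + N).
  rewrite /char_poly -det_mulmx.
  rewrite (_ : _ *m _ = ('X - lam%:P) *: char_poly_mx (J + N)) ?detZ//.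
  rewrite /char_poly_mx !map_mxD map_scalar_mx /=.
  have JyN : map_mx polyC J *m map_mx polyC N = lam%:P *: map_mx polyC N.
    by rewrite -map_mxM /N mulmxA Jy -scalemxAl map_mxZ.
  rewrite !opprD !mulmxDl !mulmxDr !mulNmx !mulmxN JyN !mul_scalar_mx !mul_mx_scalar.
  set a := map_mx _ J; set b := map_mx _ N.
  apply/matrixP => i j; rewrite !mxE; ring.
have monicn (X : 'M[F]_n) : char_poly X != 0 by rewrite monic_neq0// char_poly_monic.
have Xn : ('X - lam%:P) ^+ n != 0 by rewrite monic_neq0// monic_exp// monicXsubC.
(* Multiplicities of [lam] give [1 + mup (N + lam) = n + mup (J + N)], and the last term is at least
   [1] by [root0]. *)
have := congr1 (mup lam) key.
rewrite !mupM// mu1 mup_XsubCX eqxx => E.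
have ge1 : (0 < mup lam (char_poly (J + N)))%N.
  by rewrite -XsubC_dvd// -root_factor_theorem.
have : (n <= mup lam (char_poly (N + lam%:M)))%N.
  by move: ge1; rewrite -(leq_add2l n) -E addn1 add1n ltnS.
rewrite mup_geq// => dvd.
have sz : size (('X - lam%:P) ^+ n) = size (char_poly (N + lam%:M)).
  by rewrite size_char_poly size_exp_XsubC.
have eqp : ('X - lam%:P) ^+ n = char_poly (N + lam%:M).
  apply/eqP; rewrite -eqp_monic ?char_poly_monic ?monic_exp ?monicXsubC//.
  by rewrite -dvdp_size_eqp// sz.
have scal : char_poly (lam%:M : 'M[F]_n) = ('X - lam%:P) ^+ n.
  rewrite char_poly_trig ?scalar_mx_is_trig//.
  rewrite (eq_bigr (fun=> 'X - lam%:P)) ?prodr_const ?card_ord// => i _.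
  by rewrite mxE eqxx.
have := congr1 (fun p : {poly F} => p`_n.-1) (etrans scal eqp).
rewrite !char_poly_trace// mxtraceD => /oppr_inj/eqP;
  rewrite eq_sym addrC -subr_eq0 addrAC subrr add0r.
by rewrite /N mxtrace_mulC wy mxtrace1 oner_eq0.
Qed.

Lemma char_poly_tr {F : fieldType} {n : nat} (M : 'M[F]_n) : char_poly M^T = char_poly M.
Proof.
rewrite /char_poly -[RHS]det_tr; congr (\det _).
by apply/matrixP => i j; rewrite !mxE eq_sym.
Qed.

(** [eigenvalue] refers to row vectors; since transposition keeps the characteristic polynomial,
    there is also a column eigenvector [a + i b], whose equation is split into real and imaginary
    parts. *)
Lemma spectrum_real_plane {R : realType} {n : nat} (M : 'M[R]_n) (s t : R) :
  spectrum M (Complex s t) -> exists a b : 'cV[R]_n,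
    [/\ (a != 0) || (b != 0), M *m a = s *: a - t *: b & M *m b = t *: a + s *: b].
Proof.
rewrite /spectrum eigenvalue_root_char -char_poly_tr -eigenvalue_root_char => /eigenvalueP[v vM
  v0].
exists (\col_i complex.Re (v 0 i)), (\col_i complex.Im (v 0 i)).
have E i : \sum_j v 0 j * (M i j)%:C%C = Complex s t * v 0 i.
  have := congr1 (fun X : 'rV[R[i]]_n => X 0 i) vM; rewrite !mxE => <-.
  by apply: eq_bigr => j _; rewrite !mxE.
split.
- apply: contraR v0; rewrite negb_or !negbK => /andP[/eqP a0 /eqP b0].
  apply/eqP/rowP => i; rewrite mxE [v 0 i]complexE.
  have := congr1 (fun X : 'cV[R]_n => X i 0) a0; rewrite !mxE => ->.
  have := congr1 (fun X : 'cV[R]_n => X i 0) b0; rewrite !mxE => ->.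
  by rewrite !rmorph0 mulr0 addr0.
- apply/colP => i; rewrite !mxE.
  have := congr1 (@complex.Re R) (E i); rewrite raddf_sum /=.
  case: (v 0 i) => a b /= <-; apply: eq_bigr => j _; rewrite !mxE.
  by case: (v 0 j) => c d /=; rewrite mulr0 subr0 mulrC.
- apply/colP => i; rewrite !mxE.
  have := congr1 (@complex.Im R) (E i); rewrite raddf_sum /=.
  case: (v 0 i) => a b /=; rewrite addrC => <-; apply: eq_bigr => j _; rewrite !mxE.
  by case: (v 0 j) => c d /=; rewrite mulr0 add0r mulrC.
Qed.


Lemma ex_avoid_near0 {R : realType} (s : seq R) (b : R) : 0 < b ->
  exists2 beta, 0 < beta < b & beta \notin s.
Proof.
move=> b0.
(* It is enough to stay below every positive member of [s]. *)
suff [beta /andP[B0 Bb] Bs] : exists2 beta, 0 < beta < b & forall x, x \in s -> 0 < x -> beta < x.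
  exists beta; first by rewrite B0.
  by apply/negP => /Bs/(_ B0); rewrite ltxx.
elim: s => [|x s [c /andP[c0 cb] cs]]; first by exists (b / 2) => //;
  rewrite divr_gt0// gtr_pMr// invf_lt1// ltr1n.
have [x0|x0] := ltP 0 x; last first.
  exists c; first by rewrite c0.
  by move=> z; rewrite inE => /predU1P[->|/cs//]; rewrite ltNge x0.
exists (Num.min c (x / 2)); first by rewrite lt_min c0 divr_gt0//= gt_min cb.
move=> z; rewrite inE => /predU1P[-> _|zs z0]; last by rewrite gt_min cs.
by rewrite gt_min gtr_pMr// invf_lt1// ltr1n orbT.
Qed.

Lemma spectrum_finite {R : realType} {n : nat} (M : 'M[R]_n) :
  exists s : seq R[i], forall mu, spectrum M mu -> mu \in s.
Proof.
have [s sE] := closed_field_poly_normal (char_poly (cmx M)).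
exists s => mu; rewrite /spectrum eigenvalue_root_char sE.
rewrite (monicP (char_poly_monic _)) scale1r.
by rewrite root_prod_XsubC.
Qed.

(** Add the Lyapunov inequalities for the real and imaginary parts [a], [b] of an eigenvector: the
    terms in [t] cancel by symmetry of [S], leaving [(s - beta)] times the sum of the two form
    values, so one value is positive. Both vectors are tangent because [y^T M = - y^T]. *)
Lemma ex_positive_direction {R : realType} {n : nat} (M S : 'M[R]_n) (y : 'cV[R]_n) (beta c :
    R) (nu : R[i]) :
  S^T = S -> 0 < c -> 0 < beta ->
  (forall x : 'cV[R]_n, c * (x^T *m x) 0 0 <=
       (x^T *m S *m (M *m x)) 0 0 - beta * (x^T *m S *m x) 0 0) ->
  y^T *m M = - y^T -> spectrum M nu -> beta < complex.Re nu ->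
  exists2 a : 'cV[R]_n, (y^T *m a) 0 0 = 0 & 0 < (a^T *m S *m a) 0 0.
Proof.
move=> ST c0 beta0 lyap yM; case: nu => s t /spectrum_real_plane[a [b [ab0 Ma Mb]]] /= bs.
have ya : - (y^T *m a) 0 0 = s * (y^T *m a) 0 0 - t * (y^T *m b) 0 0.
  have := congr1 (fun X : 'M[R]_1 => X 0 0) (mulmxA y^T M a).
  by rewrite yM Ma mulNmx mulmxBr -!scalemxAr !mxE => <-.
have yb : - (y^T *m b) 0 0 = t * (y^T *m a) 0 0 + s * (y^T *m b) 0 0.
  have := congr1 (fun X : 'M[R]_1 => X 0 0) (mulmxA y^T M b).
  by rewrite yM Mb mulNmx mulmxDr -!scalemxAr !mxE => <-.
(* This is [|nu + 1|^2]; [solve] below is the complex equation [(nu + 1) z = 0] in real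
   coordinates. *)
have den : 0 < (s + 1) ^+ 2 + t ^+ 2.
  by rewrite ltr_wpDr ?sqr_ge0// exprn_gt0// addr_gt0// (lt_trans beta0).
have solve (al bl : R) : - al = s * al - t * bl -> - bl = t * al + s * bl -> al = 0 /\ bl = 0.
  move=> e1 e2.
  have h1 : (s + 1) * al - t * bl = 0 by lra.
  have h2 : (s + 1) * bl + t * al = 0 by lra.
  have z1 : al * ((s + 1) ^+ 2 + t ^+ 2) = 0.
    rewrite [LHS](_ : _ = (s + 1) * ((s + 1) * al - t * bl) + t * ((s + 1) * bl + t * al));
      last ring.
    by rewrite h1 h2 !mulr0 addr0.
  have z2 : bl * ((s + 1) ^+ 2 + t ^+ 2) = 0.
    rewrite [LHS](_ : _ = (s + 1) * ((s + 1) * bl + t * al) - t * ((s + 1) * al - t * bl));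
      last ring.
    by rewrite h1 h2 !mulr0 subr0.
  by split; apply/eqP; [move/eqP: z1|move/eqP: z2]; rewrite mulf_eq0 (gt_eqF den) orbF.
have [ya0 yb0] := solve _ _ ya yb.
have pos : 0 < (a^T *m a) 0 0 + (b^T *m b) 0 0.
  have nn (x : 'cV[R]_n) : 0 <= (x^T *m x) 0 0.
    by rewrite (le_trans _ (sqr_norm_le_dotmx x))// sqr_ge0.
  have pp (x : 'cV[R]_n) : x != 0 -> 0 < (x^T *m x) 0 0.
    by move=> x0; rewrite (lt_le_trans _ (sqr_norm_le_dotmx x))// exprn_gt0// normr_gt0.
  by case/orP: ab0 => /pp h; [rewrite ltr_pwDl|rewrite ltr_wpDl].
have sym : (a^T *m S *m b) 0 0 = (b^T *m S *m a) 0 0.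
  by rewrite -(mulmxA b^T) (dotmxC b (S *m a)) trmx_mul ST.
have la := lyap a; have lb := lyap b.
rewrite Ma mulmxBr -!scalemxAr in la; rewrite Mb mulmxDr -!scalemxAr in lb.
have eB (X Y : 'M[R]_1) : (X - Y) 0 0 = X 0 0 - Y 0 0 by rewrite !mxE.
have eD (X Y : 'M[R]_1) : (X + Y) 0 0 = X 0 0 + Y 0 0 by rewrite !mxE.
have eZ (k : R) (X : 'M[R]_1) : (k *: X) 0 0 = k * X 0 0 by rewrite !mxE.
rewrite eB !eZ sym in la; rewrite eD !eZ in lb.
have main : 0 < (s - beta) * ((a^T *m S *m a) 0 0 + (b^T *m S *m b) 0 0).
  apply: lt_le_trans (mulr_gt0 c0 pos) _; move: la lb; lra.
rewrite pmulr_rgt0 ?subr_gt0// in main.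
have [a0|a0] := ltP 0 ((a^T *m S *m a) 0 0); first by exists a.
by exists b => //; move: main a0; lra.
Qed.

(** * Linearization of the flow *)

Lemma norm_mulmx_le {R : realType} {n : nat} (M : 'M[R]_n) (v : 'cV[R]_n) :
  `|M *m v| <= n%:R * `|M| * `|v|.
Proof.
apply: mx_norm_le => [|i j]; first by rewrite !mulr_ge0.
rewrite mxE (le_trans (ler_norm_sum _ _ _))//.
rewrite (@le_trans _ _ (\sum_(k < n) (`|M| * `|v|)))//; last first.
  by rewrite sumr_const card_ord -mulrA mulr_natl.
by apply: ler_sum => k _; rewrite normrM ler_pM// le_mx_entry.
Qed.

Lemma is_derive_dotmx {R : realType} {n : nat} (u v : R -> 'cV[R]_n) (du dv : 'cV[R]_n) (t : R) :
  is_derive t 1 u du -> is_derive t 1 v dv ->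
  is_derive t 1 (fun s => ((u s)^T *m v s) 0 0) ((du^T *m v t) 0 0 + ((u t)^T *m dv) 0 0).
Proof.
move=> hu hv.
rewrite (_ : (fun s => _) = \sum_k ((fun s => u s k 0) * (fun s => v s k 0))); last first.
  by apply/funext => x; rewrite mxE fct_sumE; apply: eq_bigr => k _; rewrite mxE.
rewrite !mxE -big_split /=; apply: is_derive_sum => k.
have huk : is_derive t 1 (fun s => u s k 0) (du k 0) by exact: (is_derive_mx u _ _ _).1.
have hvk : is_derive t 1 (fun s => v s k 0) (dv k 0) by exact: (is_derive_mx v _ _ _).1.
rewrite (_ : _ + _ = u t k 0 *: dv k 0 + v t k 0 *: du k 0).
  exact: (is_deriveM huk hvk).
by rewrite !mxE addrC /GRing.scale/= (mulrC (v t k 0)).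
Qed.

Lemma is_derive_mulmxl {R : realType} {n : nat} (S : 'M[R]_n) (v : R ->
    'cV[R]_n) (dv : 'cV[R]_n) (t : R) :
  is_derive t 1 v dv -> is_derive t 1 (fun s => S *m v s) (S *m dv).
Proof.
move=> hv; apply/is_derive_mx => i j.
rewrite (_ : (fun s => _) = \sum_k (S i k *: (fun s => v s k j))); last first.
  by apply/funext => x; rewrite mxE fct_sumE.
rewrite mxE; apply: is_derive_sum => k; apply: is_deriveZ.
exact: (is_derive_mx v _ _ _).1.
Qed.

Lemma is_derive_quadratic {R : realType} {n : nat} (S : 'M[R]_n) (v : R ->
    'cV[R]_n) (dv : 'cV[R]_n) (t : R) :
  S^T = S -> is_derive t 1 v dv ->
  is_derive t 1 (fun s => ((v s)^T *m S *m v s) 0 0) (2 * ((v t)^T *m S *m dv) 0 0).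
Proof.
move=> ST hv.
have -> : (fun s => ((v s)^T *m S *m v s) 0 0) = (fun s => ((v s)^T *m (S *m v s)) 0 0).
  by apply/funext => s; rewrite mulmxA.
have -> : 2 * ((v t)^T *m S *m dv) 0 0 = (dv^T *m (S *m v t)) 0 0 + ((v t)^T *m (S *m dv)) 0 0.
  by rewrite (dotmxC dv) trmx_mul ST mulmxA mulr_natl mulr2n.
by apply: is_derive_dotmx => //; exact: is_derive_mulmxl.
Qed.

Lemma dotmx_rhs {R : realType} {n : nat} (A : 'cV[R]_n -> 'M[R]_n) (y : 'cV[R]_n) :
  (y^T *m rhs A y) 0 0 = 0.
Proof.
have [->|y0] := eqVneq y 0; first by rewrite trmx0 mul0mx mxE.
have yy : (y^T *m y) 0 0 != 0.
  rewrite gt_eqF// (lt_le_trans _ (sqr_norm_le_dotmx y))// exprn_gt0//.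
  by rewrite normr_gt0.
have eBZ (k : R) (X Y : 'M[R]_1) : (k *: X - Y) 0 0 = k * X 0 0 - Y 0 0 by rewrite !mxE.
by rewrite /rhs mulmxBr -scalemxAr eBZ /rayleigh divfK// mulmxA subrr.
Qed.

Lemma solution_dotmx {R : realType} {n : nat} (A : 'cV[R]_n -> 'M[R]_n) (y : R ->
    'cV[R]_n) (t : R) :
  is_solution A y -> ((y t)^T *m y t) 0 0 = ((y 0)^T *m y 0) 0 0.
Proof.
move=> sol; apply: (@is_derive_0_is_cst _ (fun s => ((y s)^T *m y s) 0 0)) => s.
rewrite [X in is_derive _ _ _ X](_ :
  _ = ((rhs A (y s))^T *m y s) 0 0 + ((y s)^T *m rhs A (y s)) 0 0).
  exact: is_derive_dotmx.
by rewrite dotmxC !dotmx_rhs addr0.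
Qed.

Lemma norm2_eq1 {R : realType} {n : nat} (v : 'cV[R]_n) : norm2 v = 1 <-> (v^T *m v) 0 0 = 1.
Proof.
have v0 : 0 <= (v^T *m v) 0 0 by rewrite (le_trans _ (sqr_norm_le_dotmx v))// sqr_ge0.
split=> h; last by rewrite /norm2 h sqrtr1.
by rewrite -(sqr_sqrtr v0) -/(norm2 v) h expr1n.
Qed.

Lemma norm2_lt {R : realType} {n : nat} (v : 'cV[R]_n) (e : R) : 0 < e ->
  (norm2 v < e) = ((v^T *m v) 0 0 < e ^+ 2).
Proof.
move=> e0; have v0 : 0 <= (v^T *m v) 0 0 by rewrite (le_trans _ (sqr_norm_le_dotmx v))// sqr_ge0.
rewrite -[in RHS](sqr_sqrtr v0) -/(norm2 v) ltr_pXn2r// nnegrE ?sqrtr_ge0//.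
exact: ltW.
Qed.

(** Euler's relation: along [h = s *: y] the increment of [F] is exactly [s *: F y]. The scale [s]
    makes [|h| = r], so the error bound becomes [s * e] and [s] cancels. *)
Lemma jac_eigenvector {R : realType} {n : nat} (F : 'cV[R]_n -> 'cV[R]_n) (y : 'cV[R]_n)
    (J : 'M[R]_n) (lam : R) :
  (forall (c : R) v, F (c *: v) = c *: F v) -> F y = lam *: y ->
  (forall e : R, 0 < e -> exists2 r : R, 0 < r & forall h, `|h| <= r ->
     `|F (y + h) - F y - J *m h| <= e * `|h|) ->
  J *m y = lam *: y.
Proof.
move=> hF Fy approx; have [y0|y0] := eqVneq y 0.
  by rewrite y0 mulmx0 scaler0.
have ny : 0 < `|y| by rewrite normr_gt0.
apply/eqP; rewrite -subr_eq0 -normr_eq0 eq_le normr_ge0 andbT.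
apply/ler_addgt0Pr => e e0; rewrite add0r.
have [r r0 rP] := approx (e / `|y|) (divr_gt0 e0 ny).
pose s := r / `|y|; have s0 : 0 < s by rewrite divr_gt0.
have ns : `|s *: y| = s * `|y| by rewrite normrZ gtr0_norm.
have := rP (s *: y); rewrite ns divfK ?gt_eqF// => /(_ (lexx _)).
rewrite (_ : y + s *: y = (1 + s) *: y); last by rewrite scalerDl scale1r.
rewrite hF Fy -scalemxAr (_ : _ - _ - _ = - (s *: (J *m y - lam *: y))); last first.
  by move: (J *m y) (lam *: y) => a b; apply/colP => i; rewrite !mxE; ring.
rewrite normrN normrZ gtr0_norm// (_ : e / `|y| * r = s * e);
  last by rewrite /s mulrC mulrA mulrAC.
by rewrite ler_pM2l.
Qed.

(** On the sphere [rhs A y = al *: y - G] with [G = A y y - lam y] and [al = y^T G]. Subtracting the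
    linear part leaves [al *: h + (b1 + b2 + b3) *: ys - rho], where [rho] and [b2] are small by
    differentiability and the other terms are quadratic in [h]. *)
Lemma rhs_linearization {R : realType} {n : nat} (A : 'cV[R]_n -> 'M[R]_n) (ys : 'cV[R]_n)
    (J : 'M[R]_n) (lam : R) :
  (ys^T *m ys) 0 0 = 1 -> A ys *m ys = lam *: ys ->
  (forall e : R, 0 < e -> exists2 r : R, 0 < r & forall h, `|h| <= r ->
     `|A (ys + h) *m (ys + h) - A ys *m ys - J *m h| <= e * `|h|) ->
  forall e : R, 0 < e -> exists2 r : R, 0 < r & forall y, (y^T *m y) 0 0 = 1 ->
     `|y - ys| <= r -> `|rhs A y - deflation J ys lam *m (y - ys)| <= e * `|y - ys|.
Proof.
move=> ysn Ays approx e e0.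
pose N : R := n%:R; have N0 : 0 <= N by [].
pose B := J - lam%:M; pose Kb := N * `|B|; have Kb0 : 0 <= Kb by rewrite mulr_ge0.
have N1 : 0 < 2 * (N + 1) by rewrite mulr_gt0// ltr_wpDl.
(* Half of [e] pays for [rho] and [b2], at cost [(N + 1) * e1]; the other half pays for the
   quadratic terms, whose coefficients [Q] collects. *)
pose e1 := e / (2 * (N + 1)); have e10 : 0 < e1 by rewrite divr_gt0.
pose Q := N * (Kb + e1) + N * Kb + N.
have Q0 : 0 <= Q by rewrite !addr_ge0// mulr_ge0// addr_ge0// ltW.
have Q1 : 0 < 2 * (Q + 1) by rewrite mulr_gt0// ltr_wpDl.
have [r1 r10 r1P] := approx e1 e10.
exists (Num.min r1 (e / (2 * (Q + 1)))); first by rewrite lt_min r10 divr_gt0.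
move=> y yn; set h := y - ys; rewrite le_min => /andP[hr1 hr2].
have yE : y = ys + h by rewrite /h addrC subrK.
clearbody h.
have yZ (k : R) : k *: y = k *: ys + k *: h by rewrite -scalerDr -yE.
pose rho := A y *m y - A ys *m ys - J *m h.
have rhob : `|rho| <= e1 * `|h| by rewrite /rho yE; exact: r1P.
pose G := B *m h + rho.
have unit_le1 (u : 'cV[R]_n) : (u^T *m u) 0 0 = 1 -> `|u| <= 1.
  move=> u1; have := sqr_norm_le_dotmx u; rewrite u1 -[X in _ <= X](expr1n _ 2).
  by rewrite ler_pXn2r// nnegrE.
have Bh : `|B *m h| <= Kb * `|h| := norm_mulmx_le B h.
have Gb : `|G| <= (Kb + e1) * `|h| by rewrite mulrDl (le_trans (ler_normD _ _))// lerD.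
have h0 := normr_ge0 h.
pose al := (y^T *m G) 0 0; pose b1 := (h^T *m (B *m h)) 0 0.
pose b2 := (y^T *m rho) 0 0; pose b3 := (ys^T *m h) 0 0.
have GE : G = A y *m y - lam *: y.
  rewrite /G /rho /B mulmxBl mul_scalar_mx Ays yZ.
  by move: (J *m h) (A y *m y) (lam *: h) (lam *: ys) => a b c d; apply/colP => i; rewrite !mxE;
    ring.
have eD (X Y : 'M[R]_1) : (X + Y) 0 0 = X 0 0 + Y 0 0 by rewrite !mxE.
have eB (X Y : 'M[R]_1) : (X - Y) 0 0 = X 0 0 - Y 0 0 by rewrite !mxE.
have eZ (k : R) (X : 'M[R]_1) : (k *: X) 0 0 = k * X 0 0 by rewrite !mxE.
have rhsE : rhs A y = al *: y - G.
  have -> : al = rayleigh A y - lam.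
    by rewrite /al GE mulmxBr eB -scalemxAr eZ yn mulr1 /rayleigh yn divr1 mulmxA.
  by rewrite GE scalerBl opprB addrA subrK.
have rank1 (v : 'cV[R]_n) : ys *m ys^T *m v = (ys^T *m v) 0 0 *: ys.
  by rewrite -mulmxA {1}[ys^T *m v]mx11_scalar mul_mx_scalar.
have ME : deflation J ys lam *m h = - (B *m h) + (ys^T *m (B *m h)) 0 0 *: ys - b3 *: ys.
  rewrite /deflation -/B [LHS]mulmxBl mulNmx -[(_ *m B) *m h]mulmxA.
  rewrite [(1%:M - _) *m _]mulmxBl mul1mx !rank1 -/b3.
  move: ((ys^T *m (B *m h)) 0 0 *: ys) (b3 *: ys) (B *m h) => a b c.
  by apply/colP => i; rewrite !mxE; ring.
have alE : al = (ys^T *m (B *m h)) 0 0 + b1 + b2.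
  by rewrite /al /G mulmxDr eD {1}yE linearD /= mulmxDl eD.
have -> : rhs A y - deflation J ys lam *m h = al *: h + (b1 + b2 + b3) *: ys - rho.
  rewrite rhsE ME /G yZ !scalerDl.
  have -> : al *: ys = (ys^T *m (B *m h)) 0 0 *: ys + b1 *: ys + b2 *: ys.
    by rewrite alE !scalerDl.
  move: ((ys^T *m (B *m h)) 0 0 *: ys) (B *m h) (b1 *: ys) (b2 *: ys) (b3 *: ys) (al *: h) => b a
    c d f g.
  clearbody rho.
  by apply/colP => i; rewrite !mxE; ring.
have ysb := unit_le1 _ ysn; have yb := unit_le1 _ yn.
have alb : `|al| <= N * ((Kb + e1) * `|h|).
  rewrite (le_trans (dotmx_bound _ _))// ler_wpM2l//.
  by rewrite (le_trans _ Gb)// ler_piMl.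
have b1b : `|b1| <= N * (`|h| * (Kb * `|h|)).
  by rewrite (le_trans (dotmx_bound _ _))// ler_wpM2l// ler_wpM2l.
have b2b : `|b2| <= N * (e1 * `|h|).
  rewrite (le_trans (dotmx_bound _ _))// ler_wpM2l//.
  by rewrite (le_trans _ rhob)// ler_piMl.
have b3b : `|b3| <= N * (`|h| * `|h|).
  have hh := dotmx_bound h h.
  have b3E : b3 = - ((h^T *m h) 0 0 / 2).
    have := yn; rewrite yE [(ys + h)^T]linearD /= !mulmxDl !mulmxDr !eD ysn (dotmxC h ys) -/b3;
      lra.
  rewrite b3E normrN normrM (ger0_norm (_ : 0 <= 2^-1))// (le_trans _ hh)//.
  by rewrite ler_piMr// invf_le1// ler1n.
have t1 : `|al *: h + (b1 + b2 + b3) *: ys - rho| <= `|al| * `|h| + (`|b1| + `|b2| + `|b3|) +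
  `|rho|.
  rewrite (le_trans (ler_normB _ _))// lerD// (le_trans (ler_normD _ _))// !normrZ lerD//.
  rewrite (@le_trans _ _ `|b1 + b2 + b3|)//; first by rewrite ler_piMr.
  by rewrite (le_trans (ler_normD _ _))// lerD// ler_normD.
rewrite (le_trans t1)//.
have alh : `|al| * `|h| <= N * ((Kb + e1) * `|h|) * `|h| by rewrite ler_wpM2r.
have Qh : Q * `|h| <= e / 2.
  have : (Q + 1) * `|h| <= e / 2.
    move: hr2; rewrite ler_pdivlMr// mulrCA; lra.
  by rewrite mulrDl mul1r; lra.
have eh : (N + 1) * e1 = e / 2 by rewrite /e1; field; rewrite gt_eqF// ltr_wpDl.
rewrite (@le_trans _ _ (Q * `|h| * `|h| + (N + 1) * e1 * `|h|))//.
  by move: alh b1b b2b b3b rhob; rewrite /Q; lra.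
by rewrite eh -mulrDl [e in leRHS]splitr ler_wpM2r// lerD2r.
Qed.

(** * Lyapunov stability and instability *)

Lemma quadratic_bound {R : realType} {n : nat} (S : 'M[R]_n) (u v : 'cV[R]_n) :
  `|(u^T *m S *m v) 0 0| <= n%:R * (n%:R * `|S|) * (`|u| * `|v|).
Proof.
rewrite -mulmxA (le_trans (dotmx_bound _ _))// -[leRHS]mulrA ler_wpM2l//.
by rewrite [leRHS]mulrCA ler_wpM2l// norm_mulmx_le.
Qed.

(** The margin [c * x^T x] absorbs the nonlinear error, at most [Q * (c / (Q + 1)) * |x|^2]. [D]
    will be the unit sphere, where the linearization is valid. *)
Lemma lyapunov_derivative {R : realType} {n : nat} (D : set 'cV[R]_n) (f : 'cV[R]_n -> 'cV[R]_n)
    (ys : 'cV[R]_n) (M S : 'M[R]_n) (beta c : R) : 0 < c ->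
  (forall x : 'cV[R]_n, c * (x^T *m x) 0 0 <=
       (x^T *m S *m (M *m x)) 0 0 - beta * (x^T *m S *m x) 0 0) ->
  (forall e : R, 0 < e -> exists2 r : R, 0 < r & forall y, D y -> `|y - ys| <= r ->
     `|f y - M *m (y - ys)| <= e * `|y - ys|) ->
  exists2 r : R, 0 < r & forall y, D y -> `|y - ys| <= r ->
     beta * ((y - ys)^T *m S *m (y - ys)) 0 0 <= ((y - ys)^T *m S *m f y) 0 0.
Proof.
move=> c0 lyap lin.
pose Q : R := n%:R * (n%:R * `|S|); have Q0 : 0 <= Q by rewrite !mulr_ge0.
have Q1 : 0 < Q + 1 by rewrite ltr_wpDl.
have [r r0 rP] := lin (c / (Q + 1)) (divr_gt0 c0 Q1).
exists r => // y Dy yr; have {rP} := rP y Dy yr; set x := y - ys => fx.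
have lx := lyap x.
have -> : f y = M *m x + (f y - M *m x) by rewrite addrC subrK.
move: fx; set d := f y - _ => fx.
have eD (X Y : 'M[R]_1) : (X + Y) 0 0 = X 0 0 + Y 0 0 by rewrite !mxE.
rewrite mulmxDr eD.
have := quadratic_bound S x d; rewrite -/Q ler_norml => /andP[lo _].
have A : Q * (`|x| * `|d|) <= c * `|x| ^+ 2.
  rewrite (@le_trans _ _ (Q * (`|x| * (c / (Q + 1) * `|x|))))//.
    by rewrite ler_wpM2l// ler_wpM2l.
  rewrite [leLHS](_ : _ = Q / (Q + 1) * (c * `|x| ^+ 2)); last by field; rewrite gt_eqF.
  rewrite ler_piMl ?mulr_ge0 ?sqr_ge0 ?(ltW c0)//.
  by rewrite ler_pdivrMr// mul1r lerDl.
have B : c * `|x| ^+ 2 <= c * (x^T *m x) 0 0 by rewrite ler_pM2l// sqr_norm_le_dotmx.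
by move: lo lx A B; lra.
Qed.

(** The exit time is the infimum of the times with [k <= D t], and by continuity it is one of
    them. *)
Lemma first_exit {R : realType} (D : R -> R) (k T : R) : continuous D ->
  D 0 < k -> 0 <= T -> k <= D T ->
  exists t1, [/\ 0 <= t1, k <= D t1 & forall s, 0 <= s < t1 -> D s < k].
Proof.
move=> cD D0 T0 DT; pose E : set R := [set t | 0 <= t /\ k <= D t].
have hE : has_inf E by split; [exists T|exists 0 => t []].
have lb : lbound E 0 by move=> t [].
exists (inf E); split.
- by apply: lb_le_inf => //; exact: hE.1.
- rewrite leNgt; apply/negP => lt.
  have /nbhs_normP[r /= r0 rP] : \forall s \near inf E, D s < k by exact: cvgr_lt (cD _) _ lt.
  have [e [e0 De] er] := inf_adherent r0 hE.
  have /rP : `|inf E - e| < r.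
    have ie : inf E <= e by apply: ge_inf => //; exact: hE.2.
    by rewrite distrC ger0_norm ?subr_ge0// ltrBlDl.
  by rewrite ltNge De.
- move=> s /andP[s0 sE]; rewrite ltNge; apply/negP => ks.
  have : inf E <= s by apply: ge_inf => //; exact: hE.2.
  by rewrite leNgt sE.
Qed.

(** At the first exit from the ball of radius [rho], [- V] would be at least [c * rho ^+ 2], but it
    started below that and has not increased. The growth condition is imposed per solution, since it
    will be known only for those on the sphere. *)
Lemma lyapunov_stable {R : realType} {n : nat} (f : 'cV[R]_n -> 'cV[R]_n) (ys : 'cV[R]_n)
    (S : 'M[R]_n) (c r : R) : S^T = S -> 0 < c -> 0 < r ->
  (forall x : 'cV[R]_n, c * (x^T *m x) 0 0 <= - (x^T *m S *m x) 0 0) ->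
  forall eps : R, 0 < eps -> exists2 delta : R, 0 < delta &
    forall y : R -> 'cV[R]_n, (forall t : R, is_derive t 1 y (f (y t))) ->
      (forall t, `|y t - ys| <= r -> 0 <= ((y t - ys)^T *m S *m f (y t)) 0 0) ->
      norm2 (y 0 - ys) < delta -> forall t : R, 0 <= t -> norm2 (y t - ys) < eps.
Proof.
move=> ST c0 r0 Sneg eps eps0.
pose Q : R := n%:R * (n%:R * `|S|); have Q0 : 0 <= Q by rewrite !mulr_ge0.
pose rho := Num.min eps r; have rho0 : 0 < rho by rewrite lt_min eps0.
have den : 0 < Q + c + 1 by rewrite ltr_wpDl// addr_ge0// ltW.
(* Small enough that [Q * theta < c] and [theta <= 1]: the initial value of [- V] is then below
   [c * rho ^+ 2]. *)
pose theta := c / (Q + c + 1); have th0 : 0 < theta by rewrite divr_gt0.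
have th1 : theta <= 1 by rewrite ler_pdivrMr// mul1r; lra.
have thQ : Q * theta < c.
  by rewrite /theta mulrA ltr_pdivrMr// [ltLHS]mulrC ltr_pM2l//; lra.
have trho0 : 0 < theta * rho := mulr_gt0 th0 rho0.
exists (theta * rho) => //.
move=> y dy Vinc; rewrite (norm2_lt (y 0 - ys) _ trho0) => y0.
pose D t := ((y t - ys)^T *m (y t - ys)) 0 0.
pose V t := ((y t - ys)^T *m S *m (y t - ys)) 0 0.
have dx (t : R) : is_derive t 1 (fun t => y t - ys) (f (y t)).
  by rewrite -[f (y t)]subr0; apply: is_deriveB.
have dV (t : R) : is_derive t 1 V (2 * ((y t - ys)^T *m S *m f (y t)) 0 0).
  exact: (is_derive_quadratic S (fun t => y t - ys)).
have cD : continuous D.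
  move=> t; apply: is_derive1_continuous; exact: (is_derive_dotmx _ _ _ _ t (dx t) (dx t)).
have small t : D t < rho ^+ 2 -> norm2 (y t - ys) < rho by rewrite norm2_lt.
move=> t t0; apply: (@lt_le_trans _ _ rho); last by rewrite ge_min lexx.
apply: small; rewrite ltNge; apply/negP => Dt.
have D0 : D 0 < rho ^+ 2.
  by rewrite (lt_le_trans y0)// exprMn ler_piMl ?sqr_ge0// exprn_ile1// ltW.
have [t1 [t10 Dt1 before]] := first_exit D _ t cD D0 t0 Dt.
have V01 : V 0 <= V t1.
  apply: (@derive1_ge0_le _ V _ _ _ dV t10) => s /andP[s0 st1].
  rewrite mulr_ge0//; apply: Vinc.
  have Ds : D s < rho ^+ 2 by apply: before; rewrite (ltW s0).
  rewrite -(ler_pXn2r (ltn0Sn 1)) ?nnegrE ?(ltW r0)//.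
  rewrite (le_trans (sqr_norm_le_dotmx _))// (le_trans (ltW Ds))//.
  by rewrite ler_pXn2r ?nnegrE ?(ltW r0) ?(ltW rho0)// ge_min lexx orbT.
have low : - V 0 < c * rho ^+ 2.
  have := quadratic_bound S (y 0 - ys) (y 0 - ys); rewrite -/Q -expr2 => b.
  have b1 : - V 0 <= Q * `|y 0 - ys| ^+ 2 by rewrite (le_trans _ b)// -normrN ler_norm.
  apply: (le_lt_trans b1).
  have b2 : Q * `|y 0 - ys| ^+ 2 <= Q * (theta * rho) ^+ 2.
    by rewrite ler_wpM2l// (le_trans (sqr_norm_le_dotmx _))// ltW.
  apply: (le_lt_trans b2).
  rewrite exprMn mulrA ltr_pM2r ?exprn_gt0//.
  by rewrite (le_lt_trans _ thQ)// ler_wpM2l// expr2 ler_piMr// ltW.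
have := Sneg (y t1 - ys); rewrite -/(V t1) -/(D t1).
have : c * rho ^+ 2 <= c * D t1 by rewrite ler_pM2l.
by move: low V01; lra.
Qed.

(** [V t * expR (- (2 * beta) * t)] is nondecreasing, so a positive [V 0] would force exponential
    growth, against the bound [Q * r ^+ 2] on [V]. *)
Lemma lyapunov_escape {R : realType} {n : nat} (f : 'cV[R]_n -> 'cV[R]_n) (ys : 'cV[R]_n)
    (S : 'M[R]_n) (beta r : R) (y : R -> 'cV[R]_n) : S^T = S -> 0 < beta ->
  (forall t : R, is_derive t 1 y (f (y t))) ->
  (forall t, 0 <= t -> `|y t - ys| <= r) ->
  (forall t, 0 <= t -> beta * ((y t - ys)^T *m S *m (y t - ys)) 0 0 <=
     ((y t - ys)^T *m S *m f (y t)) 0 0) ->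
  ((y 0 - ys)^T *m S *m (y 0 - ys)) 0 0 <= 0.
Proof.
move=> ST beta0 dy yr growth.
pose Q : R := n%:R * (n%:R * `|S|); have Q0 : 0 <= Q by rewrite !mulr_ge0.
pose V t := ((y t - ys)^T *m S *m (y t - ys)) 0 0.
rewrite -/(V 0) leNgt; apply/negP => V0.
have dx (t : R) : is_derive t 1 (fun t => y t - ys) (f (y t)).
  by rewrite -[f (y t)]subr0; apply: is_deriveB.
have dV (t : R) : is_derive t 1 V (2 * ((y t - ys)^T *m S *m f (y t)) 0 0).
  exact: (is_derive_quadratic S (fun t => y t - ys)).
have dE (t : R) : is_derive t 1 (fun t => expR (- (2 * beta) * t)) (expR (- (2 * beta) * t) * -
  (2 * beta)).
  apply: (@is_derive1_comp _ expR (fun t => - (2 * beta) * t)).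
  rewrite (_ : (fun t => _) = - (2 * beta) *: id) //; rewrite -[X in is_derive _ _ _ X]mulr1.
  exact: is_deriveZ.
pose W t := V t * expR (- (2 * beta) * t).
pose dW t := V t *: (expR (- (2 * beta) * t) * - (2 * beta)) +
  expR (- (2 * beta) * t) *: (2 * ((y t - ys)^T *m S *m f (y t)) 0 0).
have WP (t : R) : is_derive t 1 W (dW t) by exact: (is_deriveM (dV t) (dE t)).
have bound t : 0 <= t -> V 0 * expR (2 * beta * t) <= Q * r ^+ 2.
  move=> t0; have : W 0 <= W t.
    apply: (@derive1_ge0_le _ W dW _ _ WP t0) => s /andP[/ltW s0 _].
    have g := growth s s0.
    rewrite /dW [X in 0 <= X](_ : _ = expR (- (2 * beta) * s) *
      (2 * (((y s - ys)^T *m S *m f (y s)) 0 0 - beta * V s))).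
      by rewrite mulr_ge0 ?expR_ge0// mulr_ge0// subr_ge0.
    by rewrite /GRing.scale /=; ring.
  rewrite /W mulr0 expR0 mulr1 mulNr expRN ler_pdivlMr ?expR_gt0// => /le_trans; apply.
  have := quadratic_bound S (y t - ys) (y t - ys); rewrite -/Q -/(V t) -expr2 => b.
  rewrite (le_trans (ler_norm _))// (le_trans b)// ler_wpM2l//.
  by rewrite lerXn2r ?nnegrE ?yr// (le_trans _ (yr t t0)).
have den : 0 < V 0 * (2 * beta) by rewrite !mulr_gt0.
(* At this time the estimate [1 + x <= expR x] already gives the value [V 0 + Q * r ^+ 2], which is
   too large. *)
have t0 : 0 <= Q * r ^+ 2 / (V 0 * (2 * beta)).
  by apply: divr_ge0; [apply: mulr_ge0 => //; exact: sqr_ge0|exact: ltW].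
have := bound _ t0; set t := _ / _ in t0 *; apply/negP; rewrite -ltNge.
apply: (@lt_le_trans _ _ (V 0 * (1 + 2 * beta * t))); last first.
  by rewrite ler_pM2l// expR_ge1Dx.
rewrite mulrDr mulr1 mulrA (_ : V 0 * (2 * beta) * t = Q * r ^+ 2) ?ltrDr//.
by rewrite /t mulrC divfK// gt_eqF.
Qed.

(** The point is [((1 - s^2 N) ys + 2 s a) / (1 + s^2 N)], the rational parametrization of the great
    circle through [ys] in the direction [a]. For small [s] the form is dominated by its value at
    [a]. *)
Lemma ex_unit_perturbation {R : realType} {n : nat} (S : 'M[R]_n) (ys a : 'cV[R]_n) (delta : R) :
  S^T = S -> (ys^T *m ys) 0 0 = 1 -> (ys^T *m a) 0 0 = 0 -> 0 < (a^T *m S *m a) 0 0 ->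
    0 < delta ->
  exists y, [/\ (y^T *m y) 0 0 = 1, norm2 (y - ys) < delta &
                0 < ((y - ys)^T *m S *m (y - ys)) 0 0].
Proof.
move=> ST ysn ysa Saa d0.
pose N := (a^T *m a) 0 0.
have N0 : 0 <= N by rewrite (le_trans _ (sqr_norm_le_dotmx a))// sqr_ge0.
set q := (_ *m a) 0 0 in Saa.
pose b := (a^T *m S *m ys) 0 0; pose g := (ys^T *m S *m ys) 0 0.
pose X1 := 4 * (N + N ^+ 2); pose X2 := 2 * N * `|b| + N ^+ 2 * `|g|.
have X10 : 0 <= X1 by rewrite mulr_ge0// addr_ge0// sqr_ge0.
have X20 : 0 <= X2 by rewrite addr_ge0// ?mulr_ge0// sqr_ge0.
pose m := Num.min (delta ^+ 2) q; have m0 : 0 < m by rewrite lt_min exprn_gt0.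
have den : 0 < m + X1 + X2 by lra.
(* Since [s * (m + X1 + X2) = m], both [s * X1 < delta ^+ 2] and [s * X2 < q]. [X1] controls the
   squared distance to [ys], and [X2] the deviation of the form from [k ^+ 2 * q]. *)
pose s := m / (m + X1 + X2); have s0 : 0 < s by rewrite divr_gt0.
have sden : s * (m + X1 + X2) = m by rewrite /s divfK// gt_eqF.
have sX1 : 0 <= s * X1 by rewrite mulr_ge0// ltW.
have sX2 : 0 <= s * X2 by rewrite mulr_ge0// ltW.
have sm : 0 < s * m by rewrite mulr_gt0.
have md : m <= delta ^+ 2 by rewrite ge_min lexx.
have mq : m <= q by rewrite ge_min lexx orbT.
have s1 : s <= 1.
  by rewrite ler_pdivrMr// mul1r; lra.
have ss : s ^+ 2 <= s by rewrite expr2 ler_piMr// ltW.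
have k0 : 0 < 1 + s ^+ 2 * N by rewrite ltr_pwDl// mulr_ge0// sqr_ge0.
pose k := 2 * s / (1 + s ^+ 2 * N).
have kp : 0 < k by rewrite divr_gt0// mulr_gt0.
have k2 : k <= 2 * s.
  have k1 : 1 <= 1 + s ^+ 2 * N by rewrite lerDl mulr_ge0// sqr_ge0.
  by rewrite ler_pdivrMr// ler_peMr// mulr_ge0// ltW.
pose x := k *: (a - (s * N) *: ys).
have eB (X Y : 'M[R]_1) : (X - Y) 0 0 = X 0 0 - Y 0 0 by rewrite !mxE.
have eD (X Y : 'M[R]_1) : (X + Y) 0 0 = X 0 0 + Y 0 0 by rewrite !mxE.
have eZ (c : R) (X : 'M[R]_1) : (c *: X) 0 0 = c * X 0 0 by rewrite !mxE.
have form (U : 'M[R]_n) (p : R) (v w : 'cV[R]_n) : U^T = U ->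
  ((v - p *: w)^T *m U *m (v - p *: w)) 0 0 =
    (v^T *m U *m v) 0 0 - 2 * p * (v^T *m U *m w) 0 0 + p ^+ 2 * (w^T *m U *m w) 0 0.
  move=> UT.
  have sym : (w^T *m U *m v) 0 0 = (v^T *m U *m w) 0 0.
    by rewrite -(mulmxA w^T) (dotmxC w (U *m v)) trmx_mul UT.
  rewrite [(v - p *: w)^T]linearB /= [(p *: w)^T]linearZ /= !mulmxBl !mulmxBr -!scalemxAl
    -!scalemxAr !eB !eZ sym.
  by ring.
have formx (U : 'M[R]_n) : U^T = U -> (x^T *m U *m x) 0 0 =
    k ^+ 2 * ((a^T *m U *m a) 0 0 - 2 * (s * N) * (a^T *m U *m ys) 0 0 + (s * N) ^+ 2 * (ys^T *m
      U *m ys) 0 0).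
  move=> UT; rewrite -form// /x [(k *: _)^T]linearZ /= -!scalemxAl -!scalemxAr !eZ.
  by ring.
have xx : (x^T *m x) 0 0 = k ^+ 2 * (N + (s * N) ^+ 2).
  have := formx 1%:M (trmx1 _ _); rewrite !mulmx1 => ->.
  by rewrite (dotmxC a) ysa ysn -/N mulr0 subr0 mulr1.
exists (ys + x); split.
- rewrite [(ys + x)^T]linearD /= !mulmxDl !mulmxDr !eD xx (dotmxC x) ysn /x -scalemxAr mulmxBr
  -scalemxAr eZ eB eZ.
  by rewrite ysa ysn /k; field; rewrite gt_eqF.
- rewrite addrC addKr norm2_lt// xx.
  have : k ^+ 2 <= 4 * s ^+ 2.
    have -> : 4 * s ^+ 2 = (2 * s) ^+ 2 by ring.
    by rewrite lerXn2r// nnegrE ?(ltW kp)// mulr_ge0// ltW.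
  have : (s * N) ^+ 2 <= N ^+ 2.
    by rewrite lerXn2r// ?nnegrE// ?ler_piMl// mulr_ge0// ltW.
  move=> h1 h2.
  have h3 : N + (s * N) ^+ 2 <= N + N ^+ 2 by rewrite lerD2l.
  have h4 : 0 <= N + (s * N) ^+ 2 by rewrite addr_ge0// sqr_ge0.
  have h5 := ler_pM (sqr_ge0 k) h4 h2 h3.
  rewrite (le_lt_trans h5)//.
  have h6 : s ^+ 2 * X1 <= s * X1 by rewrite ler_wpM2r.
  rewrite (_ : 4 * s ^+ 2 * (N + N ^+ 2) = s ^+ 2 * X1); last by rewrite /X1; ring.
  lra.
- rewrite addrC addKr formx// -/q -/b -/g mulr_gt0// ?exprn_gt0//.
  have hb : 2 * (s * N) * b <= s * (2 * N * `|b|).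
    rewrite (_ : 2 * (s * N) * b = s * (2 * N) * b); last by ring.
    rewrite [leRHS]mulrA; apply: ler_wpM2l; last exact: ler_norm.
    by apply: mulr_ge0; [exact: ltW|exact: mulr_ge0].
  have hg : - ((s * N) ^+ 2 * g) <= s * (N ^+ 2 * `|g|).
    rewrite -mulrN exprMn (@le_trans _ _ (s ^+ 2 * N ^+ 2 * `|g|))//.
      by apply: ler_wpM2l; [exact: mulr_ge0 (sqr_ge0 _) (sqr_ge0 _)|rewrite -normrN ler_norm].
    rewrite -mulrA; apply: ler_wpM2r => //; apply: mulr_ge0 => //; exact: sqr_ge0.
  have : s * X2 = s * (2 * N * `|b|) + s * (N ^+ 2 * `|g|) by rewrite /X2 mulrDr.
  lra.
Qed.

(** * Stationary points *)

Lemma cmx_deflation {R : realType} {n : nat} (J : 'M[R]_n) (y : 'cV[R]_n) (lam : R) :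
  cmx (deflation J y lam) = deflation (cmx J) (map_mx (real_complex R) y) (real_complex R lam).
Proof.
rewrite /cmx -!/(map_mx (real_complex R) _) /deflation map_mxB map_mxN map_mxM !map_mxB.
by rewrite map_mx1 map_scalar_mx map_mxM map_trmx.
Qed.

Lemma mulmx_id_homogeneous {R : realType} {n : nat} (A : 'cV[R]_n -> 'M[R]_n) :
  (forall (c : R) v, c != 0 -> A (c *: v) = A v) ->
  forall (c : R) x, A (c *: x) *m (c *: x) = c *: (A x *m x).
Proof.
move=> hA c x; have [->|c0] := eqVneq c 0; first by rewrite !scale0r mulmx0.
by rewrite hA// scalemxAr.
Qed.

Lemma stationary_eigenvector {R : realType} {n : nat} (A : 'cV[R]_n -> 'M[R]_n) (ys : 'cV[R]_n) :
  stationary A ys -> A ys *m ys = rayleigh A ys *: ys.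
Proof. by move=> [_ /eqP]; rewrite /rhs subr_eq0 => /eqP ->. Qed.

Lemma stationary_linearization {R : realType} {n : nat} (A : 'cV[R]_n ->
    'M[R]_n) (ys : 'cV[R]_n) :
  (forall (c : R) v, c != 0 -> A (c *: v) = A v) -> Ck_nz 3 A -> stationary A ys ->
  let M := deflation (jac A ys) ys (rayleigh A ys) in
  [/\ (0 < n)%N, ys^T *m ys = 1%:M, jac A ys *m ys = rayleigh A ys *: ys &
    forall e : R, 0 < e -> exists2 r : R, 0 < r &
      forall y, (y^T *m y) 0 0 = 1 -> `|y - ys| <= r ->
        `|rhs A y - M *m (y - ys)| <= e * `|y - ys|].
Proof.
move=> hA smooth st; have [/norm2_eq1 ysn _] := st.
have Ays := stationary_eigenvector _ _ st.
have n0 : (0 < n)%N.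
  rewrite lt0n; apply/eqP => n0; move: ysn; rewrite mxE big1; last first.
    by move=> i _; have := ltn_ord i; rewrite {2}n0.
  by move=> /eqP; rewrite eq_sym oner_eq0.
have ys0 : ys != 0.
  by apply/eqP => ys0; move: ysn; rewrite ys0 mulmx0 mxE => /eqP; rewrite eq_sym oner_eq0.
have approx (e : R) : 0 < e -> exists2 r : R, 0 < r & forall h, `|h| <= r ->
    `|A (ys + h) *m (ys + h) - A ys *m ys - jac A ys *m h| <= e * `|h|.
  apply: (derivable_partial_approx (fun w => A w *m w) ys).
    apply: filterS (near_neq0 ys ys0) => w w0 i.
    exact: (Ck_nz_mulmx_id A 1 w i smooth w0).1.
  by move=> i; exact: (Ck_nz_mulmx_id A 1 ys i smooth ys0).2.
split => //.
- by rewrite [LHS]mx11_scalar ysn.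
- exact: (jac_eigenvector (fun w => A w *m w) ys (jac A ys) _ (mulmx_id_homogeneous A hA) Ays
  approx).
- exact: rhs_linearization.
Qed.

Theorem theorem5 (R : realType) (n : nat) (A : 'cV[R]_n -> 'M[R]_n)
  (Asym : forall v : 'cV[R]_n, (A v)^T = A v)
  (Asmooth : Ck_nz 3 A)
  (Ahom : forall (alpha : R) (v : 'cV[R]_n), alpha != 0 -> A (alpha *: v) = A v) :
  (* (a) *)
  (forall y : R -> 'cV[R]_n, is_solution A y -> norm2 (y 0) = 1 ->
     forall t : R, norm2 (y t) = 1) /\
  (* (b) *)
  (forall ys : 'cV[R]_n, stationary A ys -> normalized_eigvec A ys) /\
  (* (c) *)
  (forall v : 'cV[R]_n, normalized_eigvec A v -> stationary A v) /\
  (* (d) *)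
  (forall ys : 'cV[R]_n, stationary A ys ->
     alg_mult (jac A ys) ((rayleigh A ys)%:C)%C = 1%N ->
     (forall mu : R[i], spectrum (jac A ys) mu -> mu != ((rayleigh A ys)%:C)%C ->
        rayleigh A ys < complex.Re mu) ->
     lyap_stable A ys) /\
  (* (e) *)
  (forall ys : 'cV[R]_n, stationary A ys ->
     (exists mu : R[i], spectrum (jac A ys) mu /\ complex.Re mu < rayleigh A ys) ->
     lyap_unstable A ys).
Proof.
have cons (y : R -> 'cV[R]_n) : is_solution A y -> norm2 (y 0) = 1 ->
    forall t : R, ((y t)^T *m y t) 0 0 = 1.
  by move=> sol /norm2_eq1 y0 t; rewrite (solution_dotmx A y t sol).
split; first by move=> y sol y0 t; apply/norm2_eq1; exact: cons.
split; first by move=> ys st; split; [exact: st.1|exists (rayleigh A ys); exact: stationary_eigenvector].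
split.
  move=> v [v1 [l Av]]; split => //; rewrite /rhs (_ : rayleigh A v = l) ?Av ?subrr//.
  move/norm2_eq1: v1 => v1; rewrite /rayleigh v1 divr1 -mulmxA Av -scalemxAr mxE v1 mulr1.
  by [].
have cdef ys := cmx_deflation (jac A ys) ys (rayleigh A ys).
have cyy (ys : 'cV[R]_n) : ys^T *m ys = 1%:M ->
    (map_mx (real_complex R) ys)^T *m map_mx (real_complex R) ys = 1%:M.
  by move=> h; rewrite map_trmx -map_mxM h map_mx1.
have cJ (ys : 'cV[R]_n) (l : R) : jac A ys *m ys = l *: ys ->
    cmx (jac A ys) *m map_mx (real_complex R) ys = real_complex R l *: map_mx (real_complex R) ys.
  by move=> h; rewrite -map_mxM h map_mxZ.
split.
- move=> ys st simple dom eps eps0.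
  have [n0 yy Jy lin] := stationary_linearization A ys Ahom Asmooth st.
  set M := deflation _ _ _ in lin.
  (* The value [-1] is harmless and [0] is excluded by simplicity; any other [mu] gives an
     eigenvalue [lam - mu] of [J] different from [lam], to which dominance applies. *)
  have Mneg mu : spectrum M mu -> complex.Re mu < 0.
    rewrite /spectrum /M cdef => ev.
    have [->|mu1] := eqVneq mu (-1); first by rewrite /= oppr_lt0.
    have mu0 : mu != 0.
      by apply: contraTneq ev => ->; apply: deflation_simple => //; [exact: cyy|exact: cJ].
    have evJ := eigenvalue_deflation _ _ _ _ (cyy _ yy) (cJ _ _ Jy) mu1 ev.
    have := dom _ evJ; rewrite -subr_eq0 addrAC subrr add0r oppr_eq0 => /(_ mu0).
    by case: mu {ev mu1 mu0 evJ} => a b /=; lra.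
  have [S ST [c c0 [lyap /(_ Mneg) Sneg]]] :=
    ex_lyapunov_form M 0 n0 (fun mu h => ltr0_neq0 (Mneg mu h)).
  have [r r0 rP] := lyapunov_derivative [set y | (y^T *m y) 0 0 = 1] (rhs A) ys M S 0 c c0 lyap lin.
  have [delta d0 dP] := lyapunov_stable (rhs A) ys S c r ST c0 r0 Sneg eps eps0.
  exists delta => // y sol y0 yd; apply: dP => // t tr.
  by have := rP (y t) (cons y sol y0 t) tr; rewrite mul0r.
- move=> ys st [mu [muJ mulam]] stable.
  have [n0 yy Jy lin] := stationary_linearization A ys Ahom Asmooth st.
  set M := deflation _ _ _ in lin.
  pose nu := real_complex R (rayleigh A ys) - mu.
  have nuM : spectrum M nu.
    rewrite /spectrum /M cdef; apply: deflation_eigenvalue => //; first exact: cJ.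
    by apply: contraTneq mulam => ->; rewrite /= ltxx.
  have nu0 : 0 < complex.Re nu by rewrite /nu; case: (mu) mulam => a b /=; lra.
  have [s sP] := spectrum_finite M.
  have [beta /andP[b0 bnu] bs] := ex_avoid_near0 [seq complex.Re z | z <- s] (complex.Re nu) nu0.
  have Mb z : spectrum M z -> complex.Re z != beta.
    by move=> /sP zs; apply: contraNneq bs => <-; exact: map_f.
  have [S ST [c c0 [lyap _]]] := ex_lyapunov_form M beta n0 Mb.
  have yM : ys^T *m M = - ys^T.
    have proj : ys^T *m (1%:M - ys *m ys^T) = 0.
      by rewrite mulmxBr mulmx1 mulmxA yy mul1mx subrr.
    by rewrite /M /deflation mulmxBr mulmxN !mulmxA proj mul0mx oppr0 yy mul1mx add0r.
  have [a ya Sa] := ex_positive_direction M S ys beta c nu ST c0 b0 lyap yM nuM bnu.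
  have [r r0 rP] := lyapunov_derivative [set y | (y^T *m y) 0 0 = 1] (rhs A) ys M S beta c c0 lyap lin.
  (* The assumed stability, with [eps = r], traps a solution in the region where [V] must grow. *)
  have [delta d0 dP] := stable r r0.
  have ysn : (ys^T *m ys) 0 0 = 1 by rewrite yy mxE eqxx.
  have [y0 [y01 y0d Sy0]] := ex_unit_perturbation S ys a delta ST ysn ya Sa d0.
  have [K K0 FK] : exists2 K : R, 0 < K & forall x y, `|A x *m x - A y *m y| <= K * `|x - y|.
    apply: (homogeneous_lipschitz (fun w => A w *m w)).
    + exact: mulmx_id_homogeneous.
    + by move=> v i v0; exact: (Ck_nz_mulmx_id A 1 v i Asmooth v0).1.
    + by move=> v i v0; exact: (Ck_nz_mulmx_id A 1 v i Asmooth v0).2.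
  have [L L0 LP] := rhs_lipschitz A K Ahom K0 FK.
  have [y yE sol] := ex_global_solution (rhs A) L L0 LP y0.
  have y1 : norm2 (y 0) = 1 by rewrite yE; apply/norm2_eq1.
  have near t : 0 <= t -> `|y t - ys| <= r.
    move=> t0; have := dP y sol y1; rewrite yE => /(_ y0d t t0).
    rewrite norm2_lt// => h; rewrite -(ler_pXn2r (ltn0Sn 1)) ?nnegrE ?(ltW r0)//.
    exact: le_trans (sqr_norm_le_dotmx _) (ltW h).
  have := lyapunov_escape (rhs A) ys S beta r y ST b0 sol near.
  rewrite yE leNgt Sy0 => H; suff : false by [].
  by apply: H => t t0; apply: rP; [exact: cons|exact: near].
Qed.
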